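(* Let $2\le n<\infty$. (i) Assume $m=(n-1)a+1$ for some $a\ge1$. Let $z\in\mathcal{W}_m$ and $l=(m-1)k+1$ for some $k\ge1$. Define $\hat z\in\mathcal{W}_l$ by $$\hat z:=\sum_{r=0}^{k-1}\sum_{i=1}^{m-1}z_m^rz_i\,e_{(m-1)r+i}+z_m^k\,e_l,$$ where $\{e_i\}$ denotes the standard basis of $\mathbb{C}^l$. Then $\omega'_z=\omega'_{\hat z}$. (ii) For $m=(n-1)a+1$ with $a\ge1$, let $\mathcal{S}_{m,n}:=\{\omega'_z: z\in\mathcal{W}_m\}$. If $l\ge m\ge2$ are of this form (i.e. $l,m\in\{(n-1)a+1:a\ge1\}$) and $m-1$ is a divisor of $l-1$, then $\mathcal{S}_{m,n}\subset\mathcal{S}_{l,n}$. (iii) For any $m,l\in\{(n-1)k+1:k\ge2\}$, let $p:=(m-1)(l-1)+1$, $z\in\mathcal{W}_m$ and $y\in\mathcal{W}_l$. Then $\omega'_z\sim\omega'_y$ if and only if the following equation of vectors in $\mathbb{C}^p$ holds: $$\sum_{r=0}^{l-2}\sum_{i=1}^{m-1}z_m^rz_i\,e_{(m-1)r+i}+z_m^{l-1}e_p=\sum_{r'=0}^{m-2}\sum_{i'=1}^{l-1}y_l^{r'}y_{i'}\,e_{(l-1)r'+i'}+y_l^{m-1}e_p,$$ where $\{e_i\}$ denotes the standard basis of $\mathbb{C}^p$. (iv) Assume $m=(n-1)k+1$ and $k\ge2$. Let $z\in\mathcal{W}_m$ and $y=(y_1,\ldots,y_n)\in(\mathbb{C}^n)_1$,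 and let $\omega_y$ be the Cuntz state on $\mathcal{O}_n$ by $y$. Then $\omega'_z\sim\omega_y$ if and only if $|y_n|<1$ and $z=\hat y$, where $\hat y\in(\mathbb{C}^m)_1$ is defined as $$\hat y:=\sum_{r=0}^{k-1}\sum_{j=1}^{n-1}y_n^ry_j\,e_{(n-1)r+j}+y_n^k\,e_m,$$ where $\{e_j\}$ denotes the standard basis of $\mathbb{C}^m$.
   Context: For $2\le n<\infty$, $\mathcal{O}_n$ denotes the Cuntz algebra: the universal unital C$^*$-algebra generated by $s_1,\ldots,s_n$ with $s_i^*s_j=\delta_{ij}I$ and $\sum_{i=1}^n s_is_i^*=I$. $(\mathbb{C}^m)_1$ is the set of unit vectors of $\mathbb{C}^m$ and $\mathcal{W}_m:=\{(w_1,\ldots,w_m)\in(\mathbb{C}^m)_1:|w_m|<1\}$. Convention: zeroth powers are $1$ (or $I$). Cuntz state: for $y\in(\mathbb{C}^n)_1$, $\omega_y$ is the unique (and pure) state on $\mathcal{O}_n$ with $\omega_y(s_j)=\overline{y_j}$ for $j=1,\ldots,n$. For $m=(n-1)k+1$ with $k\ge1$ and $z\in\mathcal{W}_m$, $\omega'_z$ denotes the geometric progression state of order $k$ by $z$: the unique (and pure) state on $\mathcal{O}_n$ with $\omega'_z(s_n^rs_i)=\overline{z_{(n-1)r+i}}$ for all $r=0,\ldots,k-1$, $i=1,\ldots,n-1$, and $\omega'_z(s_n^k)=\overline{z_m}$. (For $k=1$, $m=n$ and $\omega'_z$ is the Cuntz state $\omega_z$.) For states $\omega,\omega'$ on a C$^*$-algebra,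 $\omega\sim\omega'$ means that their GNS representations are unitarily equivalent. *)

(* Defs.v *)
From HB Require Import structures.
From mathcomp Require Import all_boot all_order all_algebra.
From mathcomp Require Import complex sesquilinear.
From mathcomp Require Import all_classical all_reals all_analysis.

Set Implicit Arguments.
Unset Strict Implicit.
Unset Printing Implicit Defensive.

Import Order.TTheory GRing.Theory Num.Theory.
Import numFieldNormedType.Exports.

Local Open Scope classical_set_scope.
Local Open Scope ring_scope.
Local Open Scope complex_scope.

(* Unital C*-algebras over the complex numbers R[i]. The norm is a field of its
   own: the structures algType and normedModType have no admissible join,
   because numDomainType already inherits from a ring and a norm. *)
HB.mixin Record isCStarAlgebra (R : realType) A of GRing.Algebra R[i] A := {
  star : A -> A;
  cnorm : A -> R;
  starD : forall a b : A, star (a + b) = star a + star b;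
  starZ : forall (c : R[i]) (a : A), star (c *: a) = (c^*)%R *: star a;
  starM : forall a b : A, star (a * b) = star b * star a;
  starK : involutive star;
  cnorm_eq0 : forall a : A, cnorm a = 0 -> a = 0;
  cnormD : forall a b : A, cnorm (a + b) <= cnorm a + cnorm b;
  cnormZ : forall (c : R[i]) (a : A),
    cnorm (c *: a) = complex.Re `|c| * cnorm a;
  cnormM : forall a b : A, cnorm (a * b) <= cnorm a * cnorm b;
  cnorm_star : forall a : A, cnorm (star a * a) = cnorm a ^+ 2;
  cnorm_complete : forall u : nat -> A,
    (forall e : R, 0 < e -> exists N : nat, forall i j : nat,
       (N <= i)%N -> (N <= j)%N -> cnorm (u i - u j) < e) ->
    exists a : A, forall e : R, 0 < e -> exists N : nat, forall i : nat,
       (N <= i)%N -> cnorm (u i - a) < e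
}.

#[short(type="cstarAlgType")]
HB.structure Definition CStarAlgebra (R : realType) :=
  {A of isCStarAlgebra R A & GRing.Algebra R[i] A}.

(* The inner product is linear in its first argument. *)
HB.mixin Record isHilbert (R : realType) H
    of CompleteNormedModule R[i] H := {
  hdot : {dot H for @Num.conj R[i]};
  hdotE : forall x : H, hdot x x = `|x| ^+ 2
}.

#[short(type="hilbertType")]
HB.structure Definition Hilbert (R : realType) :=
  {H of isHilbert R H & CompleteNormedModule R[i] H}.

Section CStar.
Variable R : realType.
Implicit Types A B : cstarAlgType R.

Definition star_morphism A B (f : {lrmorphism A -> B}) : Prop :=
  forall a : A, f (star a) = star (f a).

Definition cnorm_closed A (S : set A) : Prop :=
  forall a : A,
    (forall e : R, 0 < e -> exists2 b, S b & cnorm (a - b) < e) -> S a.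

Definition star_subalgebra A (S : set A) : Prop :=
  [/\ S 1,
      forall a b, S a -> S b -> S (a + b),
      forall a b, S a -> S b -> S (a * b),
      forall (c : R[i]) a, S a -> S (c *: a)
    & forall a, S a -> S (star a)].

Definition cstar_generated A (I : Type) (s : I -> A) : Prop :=
  forall S : set A, star_subalgebra S -> cnorm_closed S ->
    (forall i, S (s i)) -> S = setT.

Definition cuntz_relations n A (s : 'I_n -> A) : Prop :=
  (forall i j, star (s i) * s j = (i == j)%:R) /\
  \sum_(i < n) s i * star (s i) = 1.

(* The morphism in the universal property is unique by [cstar_generated]. *)
Definition is_cuntz_algebra n A (s : 'I_n -> A) : Prop :=
  [/\ cuntz_relations s,
      cstar_generated s
    & forall (B : cstarAlgType R) (t : 'I_n -> B), cuntz_relations t ->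
        exists2 f : {lrmorphism A -> B},
          star_morphism f & forall i, f (s i) = t i].

(* [sup] of an unbounded set is 0, so the last clause includes boundedness. *)
Definition is_state A (w : A -> R[i]) : Prop :=
  [/\ scalar w,
      forall a, 0 <= w (star a * a)
    & sup [set complex.Re `|w a| | a in [set a | cnorm a <= 1]] = 1].

Definition is_star_rep A (H : hilbertType R) (pi : A -> H -> H) : Prop :=
  [/\ forall a, linear (pi a) /\ continuous (pi a),
      forall (c : R[i]) a b x, pi (c *: a + b) x = c *: pi a x + pi b x,
      forall x, pi 1 x = x,
      forall a b x, pi (a * b) x = pi a (pi b x)
    & forall a x y, hdot (pi a x) y = hdot x (pi (star a) y)].

Definition is_GNS A (w : A -> R[i]) (H : hilbertType R)
    (pi : A -> H -> H) (Omega : H) : Prop :=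
  [/\ is_star_rep pi,
      dense (range (fun a => pi a Omega))
    & forall a, w a = hdot (pi a Omega) Omega].

Definition unitary_equiv A (H H' : hilbertType R)
    (pi : A -> H -> H) (pi' : A -> H' -> H') : Prop :=
  exists U : H -> H',
    [/\ linear U,
        forall x y, hdot (U x) (U y) = hdot x y,
        range U = setT
      & forall a x, U (pi a x) = pi' a (U x)].

Definition state_equiv A (w w' : A -> R[i]) : Prop :=
  exists (H : hilbertType R) (pi : A -> H -> H) (Omega : H),
  exists (H' : hilbertType R) (pi' : A -> H' -> H') (Omega' : H'),
    [/\ is_GNS w pi Omega, is_GNS w' pi' Omega' & unitary_equiv pi pi'].

End CStar.

(* 1-based access to a finite family x_1, ..., x_m, used only for
   1 <= j <= m; the value for j > m is the junk value 0. *)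
Definition ent (V : nmodType) m (x : 'I_m -> V) (j : nat) : V :=
  oapp x 0 (insub j.-1).

Section GeometricProgression.
Variable R : realType.

Definition centry m (z : 'rV[R[i]]_m) (j : nat) : R[i] := ent (z 0) j.

Definition std_basis l (j : nat) : 'rV[R[i]]_l :=
  \row_(i < l) (i.+1 == j)%:R.

(* The Euclidean norm; `|z| would be the sup norm. *)
Definition unit_sphere m : set 'rV[R[i]]_m :=
  [set z | \sum_(j < m) `|z 0 j| ^+ 2 = 1].

Definition Wset m : set 'rV[R[i]]_m :=
  [set z | unit_sphere z /\ `|centry z m| < 1].

(* \sum_(r < k) \sum_(1 <= i < m) z_m^r z_i e_((m-1)r+i) + z_m^k e_l;
   here l is meant to be (m - 1) * k + 1. *)
Definition gp_vec m (k l : nat) (z : 'rV[R[i]]_m) : 'rV[R[i]]_l :=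
  \sum_(0 <= r < k) \sum_(1 <= i < m)
     (centry z m ^+ r * centry z i) *: std_basis l (m.-1 * r + i)
  + centry z m ^+ k *: std_basis l l.

Variables (A : cstarAlgType R) (n : nat) (s : 'I_n -> A).

Definition is_cuntz_state (y : 'rV[R[i]]_n) (w : A -> R[i]) : Prop :=
  is_state w /\ forall j : 'I_n, w (s j) = ((y 0 j)^*)%R.

(* The order k of a state given by z in C^m is recovered from
   m = (n - 1) * k + 1. *)
Definition is_gp_state m (z : 'rV[R[i]]_m) (w : A -> R[i]) : Prop :=
  let k := (m.-1 %/ n.-1)%N in
  [/\ is_state w,
      forall r i : nat, (r < k)%N -> (1 <= i < n)%N ->
        w (ent s n ^+ r * ent s i) = ((centry z (n.-1 * r + i))^*)%R
    & w (ent s n ^+ k) = ((centry z m)^*)%R].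

Definition gp_states m : set (A -> R[i]) :=
  [set w | exists2 z : 'rV[R[i]]_m, Wset z & is_gp_state z w].

End GeometricProgression.

(* Main.v *)
Require Import Defs.
Set Warnings "-all".
From HB Require Import structures.
From mathcomp Require Import all_boot all_order all_algebra.
From mathcomp Require Import complex sesquilinear.
From mathcomp Require Import all_classical all_reals all_analysis.
From mathcomp Require Import zify ring lra.

(* Put N = s_n. For a geometric progression state w given by a unit vector z,
   the isometries t = N^r s_i (r < k, i < n) and t = N^k have ranges summing to
   1, and the equality case of Cauchy-Schwarz turns w(t) = conj z_t into
   w(a t^* ) = z_t w(a), that is, t^* Omega = z_t Omega in the GNS space.
   Multiplying isometries shows that w is also the state of the vector hat z.

   Let z, y be unit vectors with z_m conj y_m <> 1, and let B be a bounded
   functional with B(a t^* ) = z_t B(a), B(t a) = conj y_t B(a) and B(1) = 0.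
   Stripping isometries reduces B on the words s_J s_K^* to B(N^r N^*q), and
   inserting sums of s_i s_i^* gives B(N^r N^*q) = B(N^(r-q)) for r >= q and
   B(N^r) = z_m conj y_m B(N^r) = 0; hence B = 0. Applied to w - w' this gives
   uniqueness. Applied to B(a) = <a Omega, Omega'> for two vectors of one
   representation, where B(1) = <z, y> B(1), it shows that equivalent states
   have z = y once both are written with the same order. Conversely equal
   states are equivalent because the GNS representation exists. *)

Set Implicit Arguments.
Unset Strict Implicit.
Unset Printing Implicit Defensive.

Import Order.TTheory GRing.Theory Num.Theory.
Import numFieldNormedType.Exports.

Local Open Scope classical_set_scope.
Local Open Scope ring_scope.

(** * Semi-inner products *)

(** Reduces an equation to a known one: [ring] only has to check that the two differences agree. *)
Lemma linear_combination (V : zmodType) (a b x y : V) :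
  a = b -> x - y = a - b -> x = y.
Proof. by move=> -> /eqP; rewrite subrr subr_eq0 => /eqP. Qed.

Lemma le_eps_eq0 (K : numFieldType) (b x : K) : 0 <= b ->
  (forall e, 0 < e -> `|x| <= e * b) -> x = 0.
Proof.
move=> b0 H; apply/eqP; rewrite -normr_le0; apply/ler_addgt0Pr => e e0.
rewrite add0r.
have b1 : 0 < b + 1 by rewrite ltr_wpDl.
by rewrite (le_trans (H _ (divr_gt0 e0 b1)))// mulrAC ler_pdivrMr// ler_pM2l// lerDl.
Qed.

Lemma pos_min (K : numDomainType) (a b : K) : 0 < a -> 0 < b ->
  exists2 c, 0 < c & c <= a /\ c <= b.
Proof.
move=> a0 b0; have /orP[ab|ba] := real_leVge (gtr0_real a0) (gtr0_real b0).
  by exists a.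
by exists b.
Qed.

Lemma normC_Re (R : realType) (x : R[i]) : `|x| = (complex.Re `|x|)%:C%C.
Proof. by rewrite RRe_real// normr_real. Qed.

Section SemiDot.
Variables (C : numClosedFieldType) (V : lmodType C).
Implicit Types f : V -> V -> C.

Definition semi_dot f : Prop :=
  [/\ forall v, scalar (f ^~ v),
      forall u v, f u v = (f v u)^*
    & forall v, 0 <= f v v].

(** Polarisation: [f (c *: u + v) (c *: u + v)] is real for every [c]. Taking [c = 1] compares the
    imaginary parts of [f u v] and [f v u], and taking [c] the imaginary unit compares the real
    parts. *)
Lemma sesqui_ge0_semi_dot f :
    (forall v, scalar (f ^~ v)) ->
    (forall c u v w, f w (c *: u + v) = c^* * f w u + f w v) ->
    (forall v, 0 <= f v v) ->
  semi_dot f.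
Proof.
move=> linf antif f0; split=> // u v.
have E c : f (c *: u + v) (c *: u + v) =
    c * c^* * f u u + c * f u v + c^* * f v u + f v v.
  by rewrite linf !antif; ring.
have fc w : (f w w)^* = f w w by apply/CrealP; exact: ger0_real.
have H c : c^* * (f u v)^* + c * (f v u)^* = c * f u v + c^* * f v u.
  have := fc (c *: u + v); rewrite E !rmorphD !rmorphM /= !conjCK !fc => e.
  by apply: (linear_combination e); ring.
have := H 1; rewrite conjC1 !mul1r => H1.
have := H 'i; rewrite conjCi => Hi.
have {}Hi : f u v - f v u = (f v u)^* - (f u v)^*.
  by apply: (mulfI (neq0Ci C)); apply: (linear_combination (esym Hi)); ring.
apply: (mulfI (_ : 2%:R != 0 :> C)); first by rewrite pnatr_eq0.
by apply: (linear_combination (congr2 +%R (esym H1) Hi)); ring.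
Qed.

Variable f : V -> V -> C.
Hypothesis hf : semi_dot f.

Let linf : forall v, scalar (f ^~ v). Proof. by case: hf. Qed.
Let hermf : forall u v, f u v = (f v u)^*. Proof. by case: hf. Qed.
Let posf : forall v, 0 <= f v v. Proof. by case: hf. Qed.

Lemma semi_dotDl u v w : f (u + v) w = f u w + f v w.
Proof. by have := linf w 1 u v; rewrite /= scale1r mul1r. Qed.
Lemma semi_dot0l w : f 0 w = 0.
Proof. by apply: (addrI (f 0 w)); rewrite -semi_dotDl !addr0. Qed.
Lemma semi_dotZl c u w : f (c *: u) w = c * f u w.
Proof. by have := linf w c u 0; rewrite /= !addr0 semi_dot0l addr0. Qed.
Lemma semi_dotDr u v w : f w (u + v) = f w u + f w v.
Proof. by rewrite hermf semi_dotDl rmorphD /= -!hermf. Qed.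
Lemma semi_dotZr c u w : f w (c *: u) = c^* * f w u.
Proof. by rewrite hermf semi_dotZl rmorphM /= -!hermf. Qed.

Lemma semi_dot_CauchySchwarz u v : `|f u v| ^+ 2 <= f u u * f v v.
Proof.
have E t : 0 <= f u u - t^* * f u v - t * (f u v)^* + t * t^* * f v v.
  have := posf (u - t *: v).
  rewrite -scaleNr !(semi_dotDl, semi_dotDr, semi_dotZl, semi_dotZr).
  by rewrite rmorphN (hermf v u); congr (0 <= _); ring.
have [fv0|fv0] := eqVneq (f v v) 0; last first.
  have := E (f u v / f v v).
  rewrite !rmorphM fmorphV /= [(f v v)^*]geC0_conj// => h.
  rewrite normCK -subr_ge0.
  suff -> : f u u * f v v - f u v * (f u v)^* = (f u u - (f u v)^* / f v v * f u v - f u v / f v v * (f u v)^* +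
      f u v / f v v * ((f u v)^* / f v v) * f v v) * f v v by exact: mulr_ge0.
  by field.
(* With [f v v = 0] the claim becomes [f u v = 0]. If [f u u = 0] as well, [t = f u v] in [E] shows
   it; otherwise [t = f u u / (f u v)^*] would give [f u u <= 0]. *)
have [fu0|fu0] := eqVneq (f u u) 0.
  have := E (f u v); rewrite fu0 fv0 !mulr0 sub0r addr0 => h.
  rewrite normCK mulrC -oppr_ge0.
  have : 0 <= (2%:R)^-1 * (- ((f u v)^* * f u v) - f u v * (f u v)^*).
    by rewrite mulr_ge0// invr_ge0.
  by congr (0 <= _); field.
have [->|fuv0] := eqVneq (f u v) 0; first by rewrite normr0 fv0 expr0n mulr0.
have := E (f u u / (f u v)^* ).
rewrite fv0 rmorphM fmorphV /= conjCK [(f u u)^*]geC0_conj// mulr0 addr0.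
rewrite !divfK ?conjC_eq0// subrr add0r oppr_ge0 => h.
by move: fu0; rewrite eq_le h posf.
Qed.

Definition sdnorm v := sqrtC (f v v).
Lemma sdnorm_ge0 v : 0 <= sdnorm v. Proof. by rewrite sqrtC_ge0. Qed.
Lemma sdnormK v : sdnorm v ^+ 2 = f v v. Proof. exact: sqrtCK. Qed.

Lemma semi_dot_norm_le u v : `|f u v| <= sdnorm u * sdnorm v.
Proof.
rewrite -(@ler_pXn2r _ 2)// ?nnegrE ?mulr_ge0// ?sdnorm_ge0//.
by rewrite exprMn !sdnormK; exact: semi_dot_CauchySchwarz.
Qed.

Lemma sdnormD u v : sdnorm (u + v) <= sdnorm u + sdnorm v.
Proof.
rewrite -(@ler_pXn2r _ 2)// ?nnegrE ?addr_ge0// ?sdnorm_ge0//.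
rewrite sqrrD !sdnormK -(ger0_norm (posf (u + v))) semi_dotDl !semi_dotDr.
rewrite addrA (le_trans (ler_normD _ _))// (ger0_norm (posf v)) lerD2r.
rewrite -addrA (le_trans (ler_normD _ _))// (ger0_norm (posf u)) lerD2l.
rewrite (le_trans (ler_normD _ _))// mulr2n lerD// ?semi_dot_norm_le//.
by rewrite mulrC semi_dot_norm_le.
Qed.

Lemma sdnormZ c v : sdnorm (c *: v) = `|c| * sdnorm v.
Proof.
rewrite /sdnorm semi_dotZl semi_dotZr mulrA -normCK sqrtCM ?nnegrE ?exprn_ge0//.
by rewrite sqrCK.
Qed.
End SemiDot.

(** * Completion of a semi-inner product space *)

Section Cauchy.
Variable I : Type.

(** [D] is a base of a Cauchy filter; its limit is the supremum of the eventual lower bounds. *)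
Lemma real_cauchy_base (R : realType) (D : I -> set R) :
    (forall i, D i !=set0) ->
    (forall i j, exists k, D k `<=` D i `&` D j) ->
    (forall e : R, 0 < e -> exists i, forall x y, D i x -> D i y -> `|x - y| <= e) ->
  exists c : R, forall e : R, 0 < e -> exists i, forall x, D i x -> `|x - c| <= e.
Proof.
move=> D0 DI Dcauchy.
pose L := [set r | exists i, forall x, D i x -> r <= x].
have bd i e x0 : (forall x y, D i x -> D i y -> `|x - y| <= e) -> D i x0 ->
    L (x0 - e) /\ ubound L (x0 + e).
  move=> De Dx0; split; first by exists i => x /(De _ _ Dx0); rewrite ler_norml; lra.
  move=> r [j Hj]; have [k Dk] := DI i j; have [x Dx] := D0 k.
  have [/(De _ _ Dx0) + /Hj] := Dk _ Dx; rewrite ler_norml; lra.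
exists (sup L) => e e0.
have [i Hi] := Dcauchy _ (divr_gt0 e0 (ltr0Sn R 1)); exists i => x Dx.
have [Lx Ux] := bd _ _ _ Hi Dx.
have hL : has_sup L by split; [exists (x - e / 2%:R) | exists (x + e / 2%:R)].
have := ub_le_sup hL.2 Lx.
have := ge_sup hL.1 Ux; rewrite ler_norml; lra.
Qed.

Lemma complex_cauchy_base (R : realType) (D : I -> set R[i]) :
    (forall i, D i !=set0) ->
    (forall i j, exists k, D k `<=` D i `&` D j) ->
    (forall e : R[i], 0 < e -> exists i, forall x y, D i x -> D i y -> `|x - y| <= e) ->
  exists c : R[i], forall e : R[i], 0 < e -> exists i, forall x, D i x -> `|x - c| <= e.
Proof.
move=> D0 DI Dcauchy.
(* The real and imaginary parts are 1-Lipschitz, so each inherits the Cauchy property. *)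
have H (p : R[i] -> R) : (forall x y, `|p x - p y|%:C%C <= `|x - y|) ->
    exists c : R, forall e : R, 0 < e -> exists i, forall x, D i x -> `|p x - c| <= e.
  move=> pL.
  have [i|i j|e e0|c Hc] := @real_cauchy_base _ (fun i => p @` D i).
  - by have [x Dx] := D0 i; exists (p x), x.
  - have [k Dk] := DI i j; exists k => _ [x /Dk[Dx1 Dx2] <-]; split; by exists x.
  - have [|i Hi] := Dcauchy e%:C%C; first by rewrite ltcR.
    exists i => _ _ [x Dx <-] [y Dy <-]; rewrite -lecR (le_trans (pL _ _))//.
    exact: Hi.
  - exists c => e /Hc[i Hi]; exists i => x Dx; apply: Hi; by exists x.
have [x y|a Ha] := H (@complex.Re R); first by rewrite -raddfB normc_ge_Re.
have [x y|b Hb] := H (@complex.Im R).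
  rewrite -raddfB normc_def lecR -sqrtr_sqr ler_wsqrtr// lerDr sqr_ge0//.
exists (a +i* b)%C => e e0; have e2 := divr_gt0 e0 (ltr0Sn _ 1).
have eE : ((complex.Re (e / 2%:R))%:C)%C = e / 2%:R.
  by rewrite RRe_real// ger0_real// ltW.
move: (e2); rewrite -eE ltcR => Re0.
have [i Hi] := Ha _ Re0; have [j Hj] := Hb _ Re0.
have [k Dk] := DI i j; exists k => x /Dk[/Hi Ra /Hj Rb].
rewrite (_ : x - _ = (complex.Re x - a)%:C%C + 'i%C * (complex.Im x - b)%:C%C).
  rewrite (le_trans (ler_normD _ _))// normrM [`|'i%C|]normc_def/= expr0n expr1n add0r sqrtr1 mul1r.
  rewrite [leRHS](splitr e) -eE.
  by rewrite lerD// normc_def/= expr0n addr0 sqrtr_sqr lecR.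
by case: x {Ra Rb} => x y; simpc.
Qed.
End Cauchy.

Lemma close_balls (K : numFieldType) (M : normedModType K) (F : set_system M)
    (x y : M) (d : K) : ProperFilter F ->
  F (ball x d) -> F (ball y d) -> `|x - y| <= d + d.
Proof.
move=> FF Fx Fy; have [z []] := filter_ex (filterI Fx Fy); rewrite -ball_normE /= => xz yz.
apply: le_trans (ler_distD z x y) _; apply: lerD; first exact: ltW.
by rewrite distrC; exact: ltW.
Qed.

Lemma norm_le_continuous (K : numFieldType) (V W : normedModType K) (g : V -> W) (c : K) :
  0 <= c -> linear g -> (forall x, `|g x| <= `|x| * c) -> continuous g.
Proof.
move=> c0 gl gc x; apply/(@cvgrPdist_lt _ _ _ (nbhs x)) => e e0.
have c1 : 0 < c + 1 by rewrite ltr_wpDl.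
near=> z.
have -> : g x - g z = g (x - z).
  by rewrite [x - z]addrC -[- z]scaleN1r gl scaleN1r addrC.
apply: (le_lt_trans (gc _)).
have : `|x - z| < e / (c + 1).
  by near: z; apply: cvgr_dist_lt => //; rewrite divr_gt0.
rewrite ltr_pdivlMr//; apply: le_lt_trans; rewrite ler_wpM2l//.
by rewrite lerDl.
Unshelve. all: by end_near. Qed.

Section Completion.
Variables (R : realType) (V : lmodType R[i]) (f : V -> V -> R[i]).
Local Notation nrm := (sdnorm f).

Definition dual_bound (phi : V -> R[i]) (e : R[i]) : Prop :=
  forall v, `|phi v| <= e * nrm v.

(** Membership in the norm closure of the functionals [f u], with [dual_bound] as the operator norm
    bound. Antilinearity of [phi] is not demanded: it passes to the limit from [f u]. *)
Definition approximable (phi : V -> R[i]) : Prop :=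
  forall e : R[i], 0 < e -> exists u, dual_bound (phi - f u) e.

(* The proof argument is what lets canonical structures on the completion
   find the axioms of [f]. *)
Definition approximable_pred (_ : semi_dot f) : {pred V -> R[i]} :=
  fun phi => `[< approximable phi >].

Hypothesis hf : semi_dot f.

Lemma dual_boundD phi psi d e : dual_bound phi d -> dual_bound psi e ->
  dual_bound (phi + psi) (d + e).
Proof.
move=> hd he v; rewrite (le_trans (ler_normD _ _))// mulrDl lerD//; exact: hd || exact: he.
Qed.

Lemma dual_boundN phi d : dual_bound phi d -> dual_bound (- phi) d.
Proof. by move=> hd v; rewrite normrN; exact: hd. Qed.

Lemma dual_boundBC phi psi d : dual_bound (phi - psi) d -> dual_bound (psi - phi) d.
Proof. by move/dual_boundN; rewrite opprB. Qed.

Lemma dual_boundZ c phi d : dual_bound phi d -> dual_bound (c *: phi) (`|c| * d).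
Proof. by move=> hd v; rewrite normrM -mulrA ler_wpM2l//; exact: hd. Qed.

Lemma dual_bound_le phi d e : d <= e -> dual_bound phi d -> dual_bound phi e.
Proof. by move=> de hd v; rewrite (le_trans (hd v))// ler_wpM2r// sdnorm_ge0. Qed.

Lemma dual_bound_form u : dual_bound (f u) (nrm u).
Proof. by move=> v; exact: semi_dot_norm_le. Qed.

Lemma semi_dotfD u v : f (u + v) = f u + f v.
Proof. by apply/funext => w; exact: semi_dotDl. Qed.

Lemma semi_dotfZ c u : f (c *: u) = c *: f u.
Proof. by apply/funext => w; exact: semi_dotZl. Qed.

Lemma semi_dotfB u v : f (u - v) = f u - f v.
Proof. by rewrite semi_dotfD -scaleN1r semi_dotfZ scaleN1r. Qed.

Lemma approximable_form u : approximable (f u).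
Proof. by move=> e e0; exists u => v; rewrite subrr normr0 mulr_ge0 ?sdnorm_ge0// ltW. Qed.

Lemma approximable_submod : submod_closed (approximable_pred hf).
Proof.
split.
  apply/asboolP; have -> : 0 = f 0 :> (V -> _); last exact: approximable_form.
  by apply/funext => v; rewrite semi_dot0l.
move=> c phi psi /asboolP hp /asboolP hq; apply/asboolP => e e0.
have c1 : 0 < `|c| + 1 by rewrite ltr_wpDl.
have [u hu] := hp _ (divr_gt0 (divr_gt0 e0 (ltr0Sn _ 1)) c1).
have [v hv] := hq _ (divr_gt0 e0 (ltr0Sn _ 1)).
exists (c *: u + v); rewrite semi_dotfD semi_dotfZ opprD addrACA -scalerBr.
apply: (dual_bound_le _ (dual_boundD (dual_boundZ c hu) hv)).
rewrite [leRHS](splitr e) lerD2r mulrA ler_pdivrMr// mulrC.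
by rewrite ler_pM2l ?divr_gt0// lerDl.
Qed.

HB.instance Definition _ :=
  GRing.isSubmodClosed.Build R[i] (V -> R[i]) (approximable_pred hf) approximable_submod.

Lemma approximable_antilinear phi : approximable phi ->
  forall c u v, phi (c *: u + v) = c^* * phi u + phi v.
Proof.
move=> hp c u v; apply/eqP; rewrite -subr_eq0; apply/eqP.
apply: (@le_eps_eq0 _ (nrm (c *: u + v) + `|c| * nrm u + nrm v)).
  by rewrite !addr_ge0// ?mulr_ge0// sdnorm_ge0.
move=> e /hp[x hx].
have E : f x (c *: u + v) = c^* * f x u + f x v by rewrite semi_dotDr ?semi_dotZr.
have -> : phi (c *: u + v) - (c^* * phi u + phi v) =
    (phi - f x) (c *: u + v) - c^* * (phi - f x) u - (phi - f x) v.
  by rewrite -[LHS]subr0 -(subrr (f x (c *: u + v))) {2}E !fctE; ring.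
rewrite [leRHS]mulrDr [X in _ <= X + _]mulrDr (le_trans (ler_normB _ _))// lerD ?hx//.
rewrite (le_trans (ler_normB _ _))// lerD ?hx//.
by rewrite normrM norm_conjC mulrCA ler_wpM2l//; exact: hx.
Qed.

Lemma approximableB phi : approximable phi -> forall u v, phi (u - v) = phi u - phi v.
Proof.
move=> hp u v; have := approximable_antilinear hp (-1) v u.
by rewrite scaleN1r addrC => ->; rewrite rmorphN1 mulN1r addrC.
Qed.

Lemma approximable_bounded phi : approximable phi ->
  exists2 B : R[i], 0 < B & dual_bound phi B.
Proof.
move=> /(_ 1 ltr01)[u hu]; exists (1 + nrm u); first by rewrite ltr_wpDr ?sdnorm_ge0.
rewrite -(subrK (f u) phi); exact: dual_boundD hu (dual_bound_form u).
Qed.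

(* The value of <phi, psi> is the limit of [phi v] as [f v] tends to [psi]. *)
Definition is_dual_dot (phi psi : V -> R[i]) (c : R[i]) : Prop :=
  forall e, 0 < e -> exists2 d, 0 < d &
    forall v, dual_bound (psi - f v) d -> `|phi v - c| <= e.

(** Evaluate [f u] at [u] itself: [nrm u ^+ 2 <= d * nrm u]. *)
Lemma dual_bound_sdnorm u d : 0 <= d -> dual_bound (f u) d -> nrm u <= d.
Proof.
move=> d0 /(_ u); rewrite (ger0_norm _); last by case: hf.
rewrite -sdnormK expr2; have [->//|n0] := eqVneq (nrm u) 0.
by rewrite ler_pM2r// lt_def n0 sdnorm_ge0.
Qed.

Lemma dual_bound_sdnormB psi u v d : dual_bound (psi - f u) d ->
  dual_bound (psi - f v) d -> 0 < d -> nrm (u - v) <= d + d.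
Proof.
move=> hu hv d0; apply: dual_bound_sdnorm; first by rewrite addr_ge0// ltW.
by have := dual_boundD (dual_boundBC hu) hv; rewrite addrA subrK -semi_dotfB.
Qed.

Lemma is_dual_dot_exists phi psi : approximable phi -> approximable psi ->
  exists c, is_dual_dot phi psi c.
Proof.
move=> hphi hpsi.
have [B B0 hB] := approximable_bounded hphi.
pose I := {d : R[i] | 0 < d}.
have [i|i j|e e0|c Hc] := @complex_cauchy_base I R
  (fun d => [set phi v | v in [set v | dual_bound (psi - f v) (val d)]]).
- by have [v hv] := hpsi _ (valP i); exists (phi v), v.
- have [k k0 [ki kj]] := pos_min (valP i) (valP j).
  exists (exist _ k k0 : I) => _ [v /= hv <-]; split; exists v => //=;
  exact: dual_bound_le hv.
(* Two vectors whose functionals are within [d] of [psi] differ by at most [2 d] in seminorm, so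
   their values under [phi] differ by at most [2 d B], which is [e] for this [d]. *)
- have d0 : 0 < e / B / 2%:R by rewrite !divr_gt0.
  exists (exist _ (e / B / 2%:R) d0 : I) => _ _ [u /= hu <-] [v /= hv <-].
  rewrite -approximableB// (le_trans (hB _))//.
  rewrite -[leRHS](divfK (lt0r_neq0 B0)) mulrC ler_pM2r// [leRHS]splitr.
  exact: dual_bound_sdnormB hu hv d0.
- exists c => e /Hc[[d d0] Hd]; exists d => // v hv; apply: Hd; by exists v.
Qed.

Lemma is_dual_dot_unique phi psi a b : approximable psi ->
  is_dual_dot phi psi a -> is_dual_dot phi psi b -> a = b.
Proof.
move=> hpsi ha hb; apply/eqP; rewrite -subr_eq0; apply/eqP.
apply: (@le_eps_eq0 _ 2%:R) => // e e0.
have [d1 d10 h1] := ha _ e0; have [d2 d20 h2] := hb _ e0.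
have [d d0 [dd1 dd2]] := pos_min d10 d20.
have [v hv] := hpsi _ d0.
rewrite (_ : a - b = (a - phi v) + (phi v - b)); last by ring.
rewrite (le_trans (ler_normD _ _))// mulrDr mulr1 lerD//.
  by rewrite distrC; apply: h1; exact: dual_bound_le hv.
by apply: h2; exact: dual_bound_le hv.
Qed.

Lemma is_dual_dot_form phi v : approximable phi -> is_dual_dot phi (f v) (phi v).
Proof.
move=> hphi e e0; have [B B0 hB] := approximable_bounded hphi.
have d0 : 0 < e / B / 2%:R by rewrite !divr_gt0.
exists (e / B / 2%:R) => // u hu; rewrite -approximableB// (le_trans (hB _))//.
rewrite -[leRHS](divfK (lt0r_neq0 B0)) mulrC ler_pM2r// [leRHS]splitr.
apply: (dual_bound_sdnormB hu) => //.
by move=> w; rewrite subrr normr0 mulr_ge0 ?sdnorm_ge0// ltW.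
Qed.

Lemma is_dual_dot_linear c phi phi' psi a a' :
  is_dual_dot phi psi a -> is_dual_dot phi' psi a' ->
  is_dual_dot (c *: phi + phi') psi (c * a + a').
Proof.
move=> ha ha' e e0.
have c1 : 0 < `|c| + 1 by rewrite ltr_wpDl.
have [d1 d10 h1] := ha _ (divr_gt0 e0 c1).
have [d2 d20 h2] := ha' _ (divr_gt0 e0 c1).
have [d d0 [dd1 dd2]] := pos_min d10 d20.
exists d => // v hv.
rewrite (_ : _ - _ = c * (phi v - a) + (phi' v - a')); last first.
  by rewrite -[_ v]/(c * phi v + phi' v); ring.
rewrite -[leRHS](divfK (lt0r_neq0 c1)) [leRHS]mulrDr mulr1 (le_trans (ler_normD _ _))//.
rewrite lerD//; last by apply: h2; exact: dual_bound_le hv.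
by rewrite normrM mulrC ler_wpM2r//; apply: h1; exact: dual_bound_le hv.
Qed.

(** If [f u] is close to [phi] and [f v] to [psi], then [psi u] is close to [f v u], the conjugate
    of [f u v], which is close to [phi v], hence to [c]. The bounds by 1 on the distances keep the
    seminorms of [u] and [v] below [B + 1] and [B' + 1]. *)
Lemma is_dual_dot_conj phi psi c : approximable phi -> approximable psi ->
  is_dual_dot phi psi c -> is_dual_dot psi phi c^*.
Proof.
move=> hphi hpsi hc e e0; have e2 := divr_gt0 e0 (ltr0Sn _ 1).
have [d1 d10 h1] := hc _ e2.
have [B B0 hB] := approximable_bounded hphi.
have [B' B'0 hB'] := approximable_bounded hpsi.
have e4 := divr_gt0 e2 (ltr0Sn _ 1).
have B1 : 0 < B + 1 by rewrite addr_gt0.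
have B'1 : 0 < B' + 1 by rewrite addr_gt0.
have [d2 d20 [d2e d21]] := pos_min (divr_gt0 e4 B'1) ltr01.
have [d3 d30 [d3e d31]] := pos_min (divr_gt0 e4 B1) ltr01.
have [d d0 [dd1 dd3]] := pos_min d10 d30.
exists d2 => // u hu; have [v hv] := hpsi _ d0.
have nu : nrm u <= B + 1.
  apply: dual_bound_sdnorm; rewrite ?ltW// -[f u](subKr phi).
  apply: dual_boundD => //; apply: dual_boundN; exact: dual_bound_le hu.
have nv : nrm v <= B' + 1.
  apply: dual_bound_sdnorm; rewrite ?ltW// -[f v](subKr psi).
  apply: dual_boundD => //; apply: dual_boundN; apply: dual_bound_le hv.
  exact: le_trans dd3 d31.
have fuv : f v u = (f u v)^* by case: hf.
rewrite (_ : _ - _ = (psi - f v) u - ((phi - f u) v)^* + (phi v - c)^*); last first.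
  by rewrite !fctE !rmorphB fuv /=; ring.
rewrite (le_trans (ler_normD _ _))// [leRHS]splitr lerD//; last first.
  by rewrite norm_conjC; apply: h1; exact: dual_bound_le hv.
rewrite (le_trans (ler_normB _ _))// [leRHS]splitr norm_conjC lerD//.
  rewrite (le_trans (hv u))// -[leRHS](divfK (lt0r_neq0 B1)).
  by apply: ler_pM; rewrite ?sdnorm_ge0// ?(le_trans dd3)// ltW.
rewrite (le_trans (hu v))// -[leRHS](divfK (lt0r_neq0 B'1)).
by apply: ler_pM; rewrite ?sdnorm_ge0// ltW.
Qed.

(* The Hilbert space completion of [V], realised as the closure of the
   functionals [f u] in the antidual of [V]. *)
Definition completion := {phi : V -> R[i] | approximable_pred hf phi}.

HB.instance Definition _ := [isSub of completion for @sval _ _].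
HB.instance Definition _ := [Choice of completion by <:].
HB.instance Definition _ := [SubChoice_isSubLmodule of completion by <:].

End Completion.

Section CompletionHilbert.
Variables (R : realType) (V : lmodType R[i]) (f : V -> V -> R[i]) (hf : semi_dot f).
Local Notation nrm := (sdnorm f).
Local Notation H := (completion hf).
Implicit Types x y : H.

Lemma completionP x : approximable f (val x).
Proof. exact/asboolP/(valP x). Qed.

Definition completion_of (phi : V -> R[i]) (hphi : approximable f phi) : H :=
  exist _ phi (asboolT hphi).

Definition completion_emb (u : V) : H := completion_of (approximable_form hf u).

Definition completion_dot x y : R[i] := xget 0 (is_dual_dot f (val x) (val y)).

Local Notation dot := completion_dot.
Local Notation emb := completion_emb.

Lemma completion_dotP x y : is_dual_dot f (val x) (val y) (dot x y).
Proof.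
have [c hc] := is_dual_dot_exists hf (completionP x) (completionP y).
by apply: xgetPex; exists c.
Qed.

Lemma completion_dot_unique x y c : is_dual_dot f (val x) (val y) c -> dot x y = c.
Proof.
by move=> hc; exact: (is_dual_dot_unique hf (completionP y) (completion_dotP x y) hc).
Qed.

Lemma completion_dot_emb x v : dot x (emb v) = val x v.
Proof. by apply: completion_dot_unique; exact: (is_dual_dot_form hf v (completionP x)). Qed.

Lemma completion_dot_linear y : scalar (dot ^~ y).
Proof.
move=> c x x'; apply: completion_dot_unique.
rewrite (_ : val _ = c *: val x + val x')//.
exact: is_dual_dot_linear (completion_dotP x y) (completion_dotP x' y).
Qed.

Lemma completion_dot_conj x y : dot x y = (dot y x)^*.
Proof.
apply: completion_dot_unique.
exact: (is_dual_dot_conj hf (completionP y) (completionP x) (completion_dotP y x)).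
Qed.

(** One vector [v] approximates both the functional [x] and its squared norm. This carries
    positivity and norm estimates from [V] to the completion. *)
Lemma completion_dot_close x e : 0 < e -> exists2 v,
  dual_bound f (val x - f v) e & `|f v v - dot x x| <= e.
Proof.
move=> e0; have e2 := divr_gt0 e0 (ltr0Sn _ 1).
have [d1 d10 h1] := completion_dotP x x e2.
have [B B0 hB] := approximable_bounded hf (completionP x).
have B1 : 0 < B + 1 by rewrite addr_gt0.
have [d2 d20 [d2e d21]] := pos_min (divr_gt0 e2 B1) ltr01.
have [d3 d30 [d31 d3e]] := pos_min d10 e0.
have [d d0 [dd2 dd3]] := pos_min d20 d30.
have [v hv] := completionP x d0; exists v.
  by apply: (dual_bound_le hf _ hv) => //; exact: le_trans d3e.
have nv : nrm v <= B + 1.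
  apply: (dual_bound_sdnorm hf); rewrite ?ltW// -[f v](subKr (val x)).
  apply: dual_boundD => //; apply: dual_boundN; apply: (dual_bound_le hf _ hv) => //.
  exact: le_trans d21.
rewrite (_ : _ - _ = - ((val x - f v) v) + (val x v - dot x x)); last first.
  by rewrite !fctE; ring.
rewrite (le_trans (ler_normD _ _))// [leRHS]splitr normrN lerD//.
  rewrite (le_trans (hv v))// -[leRHS](divfK (lt0r_neq0 B1)).
  by apply: ler_pM; rewrite ?sdnorm_ge0// ?(le_trans dd2)// ltW.
apply: h1; apply: (dual_bound_le hf _ hv) => //; exact: le_trans d31.
Qed.

Lemma completion_dot_ge0 x : 0 <= dot x x.
Proof.
have xr : dot x x \is Num.real by apply/CrealP; rewrite -completion_dot_conj.
apply/ler_addgt0Pr => e /(completion_dot_close x)[v _].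
have fv0 : 0 <= f v v by case: hf.
rewrite real_ler_norml ?rpredB ?(ger0_real fv0)//.
by case/andP => _; rewrite lerBlDr addrC; exact: le_trans.
Qed.

Lemma completion_semi_dot : semi_dot dot.
Proof.
split; [exact: completion_dot_linear|exact: completion_dot_conj|].
exact: completion_dot_ge0.
Qed.

Let hdot := completion_semi_dot.

(** Together with [completion_sdnorm_le], this identifies the Hilbert norm with the operator norm in
    the antidual. *)
Lemma completion_dual_bound x : dual_bound f (val x) (sdnorm dot x).
Proof.
move=> v; rewrite -completion_dot_emb (_ : nrm v = sdnorm dot (emb v)).
  exact: semi_dot_norm_le.
by rewrite /sdnorm completion_dot_emb.
Qed.

Lemma completion_sdnorm_le x d : 0 <= d -> dual_bound f (val x) d -> sdnorm dot x <= d.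
Proof.
move=> d0 hd.
rewrite -(@ler_pXn2r _ 2)// ?nnegrE ?sdnorm_ge0// sdnormK.
apply/ler_addgt0Pr => e e0.
have d2 : 0 < d * 2%:R + 2%:R by rewrite ltr_wpDl// mulr_ge0.
(* This [t] satisfies [t (2 d + 2) <= e] and [t <= 1], whence [(d + t)^2 + t <= d^2 + e]. *)
have [t t0 [te t1]] := pos_min (divr_gt0 e0 d2) ltr01.
have [v hv] := completion_dot_close x t0.
have nv : nrm v <= d + t.
  apply: (dual_bound_sdnorm hf); first by rewrite addr_ge0// ltW.
  rewrite -[f v](subKr (val x)); apply: dual_boundD => //; exact: dual_boundN.
have fv0 : 0 <= f v v by case: hf.
rewrite real_ler_norml ?rpredB ?ger0_real ?completion_dot_ge0//.
case/andP; rewrite lerBrDr addrC lerBlDr => + _ => /le_trans; apply.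
rewrite -sdnormK.
have : nrm v ^+ 2 <= (d + t) ^+ 2.
  by rewrite ler_pXn2r// nnegrE ?sdnorm_ge0// addr_ge0// ltW.
rewrite -(lerD2r t) => /le_trans; apply.
have : t * (d * 2%:R + 2%:R) <= e by rewrite -ler_pdivlMr.
rewrite -(lerD2l (d ^+ 2)); apply: le_trans.
rewrite -subr_ge0 (_ : _ - _ = t * (1 - t)); last by ring.
by rewrite mulr_ge0 ?subr_ge0// ltW.
Qed.

Lemma completion_sdnorm_eq0 x : sdnorm dot x = 0 -> x = 0.
Proof.
move=> x0; apply: val_inj; apply/funext => v /=.
by apply/eqP; rewrite -normr_le0; have := completion_dual_bound x v; rewrite x0 mul0r.
Qed.

HB.instance Definition _ := @Lmodule_isNormed.Build R[i] H (sdnorm dot)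
  (sdnormD hdot) (sdnormZ hdot) completion_sdnorm_eq0.

HB.instance Definition _ := bilinear_isBilinear.Build R[i] H H R[i] *%R
  (@Num.conj R[i] \; *%R) dot
  (completion_dot_linear, fun u c v w => eq_trans (semi_dotDr hdot _ _ _) (congr1 (fun t => t + _) (semi_dotZr hdot _ _ _))).

HB.instance Definition _ := @isHermitianSesquilinear.Build R[i] H false (@Num.conj R[i])
  dot (fun x y => eq_trans (completion_dot_conj x y) (esym (mul1r _))).

Lemma completion_norm_dot x : dot x x = `|x| ^+ 2.
Proof. by rewrite -sdnormK. Qed.

Lemma completion_dot_gt0 x : x != 0 -> 0 < dot x x.
Proof. by move=> x0; rewrite completion_norm_dot exprn_gt0// normr_gt0. Qed.

HB.instance Definition _ := isDotProduct.Build R[i] H dot completion_dot_gt0.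

(** The limit is built pointwise as a functional. The Cauchy condition makes the convergence uniform
    in the operator norm, so the limit is again approximable. *)
Lemma completion_complete (F : set_system H) : ProperFilter F -> cauchy F -> cvg F.
Proof.
move=> FF /cauchyP Fc; apply/cvg_ex.
have close_val x y d v : F (ball x d) -> F (ball y d) ->
    `|val x v - val y v| <= (d + d) * nrm v.
  move=> Fx Fy; rewrite (_ : _ - _ = val (x - y) v)//.
  by rewrite (le_trans (completion_dual_bound _ _))// ler_wpM2r ?sdnorm_ge0//; exact: close_balls Fx Fy.
pose I := {d : R[i] | 0 < d}.
have ball_sub x d d' : d <= d' -> F (ball x d) -> F (ball x d').
  by move=> dd; apply: filterS => y; exact: le_ball.
have /choice[phi Hphi] v : exists c : R[i], forall e : R[i], 0 < e ->
    exists2 d : R[i], 0 < d & forall x, F (ball x d) -> `|val x v - c| <= e.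
  have [i|i j|e e0|c Hc] := @complex_cauchy_base I R
    (fun d => [set val x v | x in [set x | F (ball x (val d))]]).
  - by have [x hx] := Fc _ (valP i); exists (val x v), x.
  - have [k k0 [ki kj]] := pos_min (valP i) (valP j).
    by exists (exist _ k k0 : I) => _ [x /= hx <-]; split; exists x => //=;
      apply: ball_sub hx.
  - have n1 : 0 < nrm v + 1 by rewrite ltr_wpDl ?sdnorm_ge0.
    have d0 : 0 < e / (nrm v + 1) / 2%:R by rewrite !divr_gt0.
    exists (exist _ (e / (nrm v + 1) / 2%:R) d0 : I) => _ _ [x /= hx <-] [y /= hy <-].
    rewrite (le_trans (close_val _ _ _ _ hx hy))// -splitr mulrAC ler_pdivrMr//.
    by rewrite ler_pM2l// lerDl.
  - by exists c => e /Hc[[d d0] Hd]; exists d => // x hx; apply: Hd; exists x.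
have bound x d : 0 < d -> F (ball x d) -> dual_bound f (val x - phi) (d + d).
  move=> d0 Fx v; apply/ler_addgt0Pr => e /(Hphi v)[d' d'0 H'].
  have [k k0 [kd kd']] := pos_min d0 d'0; have [y Fy] := Fc _ k0.
  rewrite (_ : (val x - phi) v = (val x v - val y v) + (val y v - phi v)); last first.
    by rewrite !fctE; ring.
  apply: le_trans (ler_normD _ _) _; apply: lerD.
    exact: (close_val _ _ _ _ Fx (ball_sub _ _ _ kd Fy)).
  exact: (H' _ (ball_sub _ _ _ kd' Fy)).
(* A ball of radius [e / 4] yields by [bound] a distance of at most [e / 2] to [phi], leaving
   [e / 2] for the second approximation. *)
have e4 (e : R[i]) : 0 < e -> 0 < e / 2%:R / 2%:R by move=> e0; rewrite !divr_gt0.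
have phiA : approximable f phi.
  move=> e e0; have [x Fx] := Fc _ (e4 _ e0).
  have [u hu] := completionP x (divr_gt0 e0 (ltr0Sn _ 1)); exists u.
  have := dual_boundD (dual_boundBC (bound _ _ (e4 _ e0) Fx)) hu.
  by rewrite addrA subrK -!splitr.
exists (completion_of phiA); apply/fcvgrPdist_lt => e e0.
have [x Fx] := Fc _ (e4 _ e0); move: (Fx); apply: filterS => y; rewrite -ball_normE /= => xy.
apply: le_lt_trans (ler_distD x _ y) _.
rewrite [ltRHS]splitr; apply: ler_ltD; last first.
  by apply: (lt_trans xy); rewrite ltr_pdivrMr// ltr_pMr ?divr_gt0// ltr1n.
rewrite distrC [leRHS]splitr; apply: completion_sdnorm_le.
  by apply: addr_ge0; apply: ltW; exact: e4.
exact: bound (e4 _ e0) Fx.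
Qed.

HB.instance Definition _ := Uniform_isComplete.Build H completion_complete.

HB.instance Definition _ := isHilbert.Build R H completion_norm_dot.

End CompletionHilbert.

(** * States and the GNS construction *)

Section StarAlgebra.
Variables (R : realType) (A : cstarAlgType R).
Implicit Types a b : A.

Lemma star1 : star 1 = 1 :> A.
Proof. by have /(congr1 star) := mulr1 (star (1 : A)); rewrite starM !starK mulr1. Qed.

Lemma star0 : star 0 = 0 :> A.
Proof. by apply: (addrI (star (0 : A))); rewrite -starD !addr0. Qed.

Lemma starN a : star (- a) = - star a.
Proof. by apply: (addrI (star a)); rewrite -starD !subrr star0. Qed.

Lemma starB a b : star (a - b) = star a - star b.
Proof. by rewrite starD starN. Qed.

Lemma cnorm0 : cnorm (0 : A) = 0.
Proof. by rewrite -(scale0r (0 : A)) cnormZ normr0 mul0r. Qed.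

Lemma cnormN a : cnorm (- a) = cnorm a.
Proof. by rewrite -scaleN1r cnormZ normrN1 mul1r. Qed.

Lemma cnorm_ge0 a : 0 <= cnorm a.
Proof.
have := cnormD a (- a); rewrite subrr cnorm0 cnormN -mulr2n.
by rewrite pmulrn_lge0.
Qed.

Lemma cnorm1_le : cnorm (1 : A) <= 1.
Proof.
have := cnorm_star (1 : A); rewrite star1 mulr1 => h.
have [->|n0] := eqVneq (cnorm (1 : A)) 0; first exact: ler01.
have -> : cnorm (1 : A) = 1 by apply: (mulfI n0); rewrite -expr2 -h mulr1.
by [].
Qed.

End StarAlgebra.

Section States.
Variables (R : realType) (A : cstarAlgType R) (w : A -> R[i]).
Hypothesis hw : is_state w.
Implicit Types a b : A.

Lemma state_scalar : scalar w. Proof. by case: hw. Qed.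

Lemma stateD a b : w (a + b) = w a + w b.
Proof. by have := state_scalar 1 a b; rewrite scale1r mul1r. Qed.

Lemma state0 : w 0 = 0.
Proof. by apply: (addrI (w 0)); rewrite -stateD !addr0. Qed.

Lemma stateZ c a : w (c *: a) = c * w a.
Proof. by have := state_scalar c a 0; rewrite state0 !addr0. Qed.

Lemma stateB a b : w (a - b) = w a - w b.
Proof. by rewrite stateD -scaleN1r stateZ mulN1r. Qed.

Lemma state_sum (I : Type) (r : seq I) (P : pred I) (F : I -> A) :
  w (\sum_(i <- r | P i) F i) = \sum_(i <- r | P i) w (F i).
Proof. exact: (big_morph w stateD state0). Qed.

Definition state_form a b : R[i] := w (star b * a).

Lemma state_form_semi_dot : semi_dot state_form.
Proof.
apply: sesqui_ge0_semi_dot => [b c x y|c u v x|v]; rewrite /state_form.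
- by rewrite mulrDr -scalerAr state_scalar.
- by rewrite starD starZ mulrDl -scalerAl state_scalar.
- by case: hw.
Qed.

Lemma state_star a : w (star a) = (w a)^*.
Proof.
have [_ /(_ 1 a) + _] := state_form_semi_dot.
by rewrite /state_form mulr1 star1 mul1r.
Qed.

Lemma state_norm_le a : `|w a| <= (cnorm a)%:C%C.
Proof.
have [_ _ hsup] := hw.
set S := [set _ | _ in _] in hsup.
(* Without a supremum, [sup S] would take the default value 0 instead of 1. *)
have Ssup : has_sup S.
  by apply: contrapT => /sup_out; rewrite hsup => /eqP; rewrite oner_eq0.
have S1 b : cnorm b <= 1 -> complex.Re `|w b| <= 1.
  by move=> b1; rewrite -hsup; apply: ub_le_sup; [exact: Ssup.2|exists b].
have [a0|a0] := eqVneq (cnorm a) 0.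
  by rewrite (cnorm_eq0 _ a0) state0 normr0 cnorm0.
have an : 0 < cnorm a by rewrite lt_def a0 cnorm_ge0.
have /S1 : cnorm (((cnorm a)^-1)%:C%C *: a) <= 1.
  rewrite cnormZ normc_def/= expr0n addr0 sqrtr_sqr ger0_norm ?invr_ge0 ?(ltW an)//.
  by rewrite mulVf.
rewrite stateZ normrM [`|w a|]normC_Re normc_def/= expr0n addr0 sqrtr_sqr.
rewrite ger0_norm ?invr_ge0 ?(ltW an)// mulr0 subr0 lecR.
by rewrite mulrC ler_pdivrMr// mul1r.
Qed.

(** Contractivity gives [w 1 <= 1]. Conversely, Cauchy-Schwarz against 1 bounds [|w a|] by the
    square root of [w 1] for every contraction [a], and the supremum of these values is 1. *)
Lemma state1 : w 1 = 1.
Proof.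
have w10 : 0 <= w 1 by case: hw => _ /(_ 1); rewrite star1 mulr1.
have w11 : w 1 <= 1.
  rewrite -(ger0_norm w10) (le_trans (state_norm_le _))//.
  by rewrite (_ : 1 = 1%:C%C)// lecR cnorm1_le.
apply/eqP; rewrite eq_le w11/=.
have [_ _ hsup] := hw.
suff : 1 <= sqrtC (w 1) by rewrite -(@ler_pXn2r _ 2)// ?nnegrE ?sqrtC_ge0// expr1n sqrtCK.
have sr : sqrtC (w 1) = (complex.Re (sqrtC (w 1)))%:C%C.
  by rewrite RRe_real// ger0_real// sqrtC_ge0.
rewrite sr (_ : 1 = 1%:C%C)// lecR -hsup; apply: ge_sup.
  by exists (complex.Re `|w 0|), 0 => //=; rewrite cnorm0.
move=> _ [a /= a1 <-]; rewrite -lecR -sr -normC_Re.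
rewrite -(@ler_pXn2r _ 2)// ?nnegrE ?sqrtC_ge0// sqrtCK.
have := semi_dot_CauchySchwarz state_form_semi_dot a 1.
rewrite /state_form star1 mul1r mulr1 => /le_trans; apply.
have wa0 : 0 <= w (star a * a) by case: hw.
rewrite ler_piMl// -(ger0_norm wa0) (le_trans (state_norm_le _))//.
rewrite (_ : 1 = 1%:C%C)// lecR cnorm_star.
by rewrite exprn_ile1// cnorm_ge0.
Qed.

(* Let M be the supremum of |w (b^* x b)| over self-adjoint contractions x.
   Cauchy-Schwarz gives |w (b^* x b)|^2 <= w (b^* b) w (b^* x^2 b), hence
   M^2 <= w (b^* b) M; this replaces the functional calculus. *)
Lemma state_selfadjoint_le b h : star h = h -> cnorm h <= 1 ->
  `|w (star b * h * b)| <= w (star b * b).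
Proof.
move=> hs h1.
have wb0 : 0 <= w (star b * b) by case: hw.
pose S := [set complex.Re `|w (star b * x * b)| | x in [set x | star x = x /\ cnorm x <= 1]].
have cM (x y : A) : cnorm y <= 1 -> cnorm (x * y) <= cnorm x.
  by move=> y1; rewrite (le_trans (cnormM _ _))// ler_piMr ?cnorm_ge0.
have Su : has_ubound S.
  exists (cnorm (star b) * cnorm b) => _ [x [xs x1] <-]; rewrite -lecR -normC_Re.
  apply: (le_trans (state_norm_le _)); rewrite lecR.
  by rewrite (le_trans (cnormM _ _))// ler_wpM2r ?cnorm_ge0// cM.
set al := w (star b * b) in wb0 *.
have alE : al = (complex.Re al)%:C%C by rewrite RRe_real// ger0_real.
have al0 : 0 <= complex.Re al by rewrite -lecR -alE.
have bd x : star x = x -> cnorm x <= 1 -> complex.Re `|w (star b * x * b)| ^+ 2 <= complex.Re al * sup S.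
  move=> xs x1; rewrite -lecR rmorphXn rmorphM /= -normC_Re -alE.
  have := semi_dot_CauchySchwarz state_form_semi_dot (x * b) b.
  rewrite /state_form !mulrA => /le_trans; apply; rewrite mulrC ler_wpM2l//.
  have p0 : 0 <= w (star (x * b) * x * b) by rewrite -mulrA; case: hw => _ + _; apply.
  rewrite -(ger0_norm p0).
  rewrite normC_Re lecR; apply: ub_le_sup => //; exists (x * x) => /=.
    by rewrite starM xs; split=> //; exact: le_trans (cM _ _ x1) x1.
  by rewrite starM xs !mulrA.
have S0 : S !=set0.
  exists (complex.Re `|w (star b * 0 * b)|), 0 => //=.
  by rewrite star0 cnorm0; split.
have Sge0 : 0 <= sup S.
  apply: le_trans (ub_le_sup Su _); last first.
    by exists 0; [rewrite /= star0 cnorm0|reflexivity].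
  by rewrite mulr0 mul0r state0 normr0.
have SS : sup S <= complex.Re al.
  have : sup S <= Num.sqrt (complex.Re al * sup S).
    apply: ge_sup => // _ [x [xs x1] <-].
    rewrite -[leLHS]ger0_norm; last by rewrite -lecR -normC_Re; exact: normr_ge0.
    by rewrite -sqrtr_sqr ler_wsqrtr// bd.
  rewrite -(@ler_pXn2r _ 2)// ?nnegrE ?sqrtr_ge0// sqr_sqrtr ?mulr_ge0//.
  by have [->//|n0] := eqVneq (sup S) 0; rewrite expr2 ler_pM2r// lt_def n0.
rewrite normC_Re alE lecR (le_trans _ SS)//; apply: ub_le_sup => //.
by exists h.
Qed.

(** Apply [state_selfadjoint_le] to the self-adjoint contraction [star a * a] divided by
    [cnorm a ^+ 2]. This is what makes left multiplication bounded in the GNS seminorm. *)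
Lemma state_contract a b :
  w (star (a * b) * (a * b)) <= (cnorm a ^+ 2)%:C%C * w (star b * b).
Proof.
have wb0 : 0 <= w (star b * b) by case: hw.
have [a0|a0] := eqVneq (cnorm a) 0.
  by rewrite (cnorm_eq0 _ a0) mul0r mulr0 state0 cnorm0 expr0n mul0r.
have an : 0 < cnorm a by rewrite lt_def a0 cnorm_ge0.
have nn : `|((cnorm a ^+ 2)^-1)%:C%C| = ((cnorm a ^+ 2)^-1)%:C%C :> R[i].
  by rewrite ger0_norm// lecR invr_ge0 exprn_ge0// ltW.
have := @state_selfadjoint_le b (((cnorm a ^+ 2)^-1)%:C%C *: (star a * a)).
rewrite starZ starM starK cnormZ cnorm_star nn /=.
rewrite mulVf ?expf_neq0// => h.
have /h : (((cnorm a ^+ 2)^-1)%:C%C^* *: (star a * a) = ((cnorm a ^+ 2)^-1)%:C%C *: (star a * a)).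
  by congr (_ *: _); apply/CrealP; rewrite ger0_real// lecR invr_ge0 exprn_ge0// ltW.
move=> /(_ (lexx _)).
rewrite -scalerAr -scalerAl stateZ normrM nn fmorphV/= mulrC ler_pdivrMr; last first.
  by rewrite ltcR exprn_gt0.
rewrite mulrC !mulrA starM ger0_norm//.
by rewrite -mulrA -starM; case: hw => _ + _; exact.
Qed.

End States.

(** * The GNS representation of a state *)

Section GNS.
Variables (R : realType) (A : cstarAlgType R) (w : A -> R[i]).
Hypothesis hw : is_state w.
Let hf := state_form_semi_dot hw.
Local Notation H := (completion hf).
Local Notation nrm := (sdnorm (state_form w)).

Lemma state_form_contract a b : nrm (a * b) <= (cnorm a)%:C%C * nrm b.
Proof.
have c0 : 0 <= (cnorm a)%:C%C by rewrite lecR cnorm_ge0.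
rewrite -(@ler_pXn2r _ 2)// ?nnegrE ?mulr_ge0 ?(sdnorm_ge0 hf)//.
by rewrite exprMn !sdnormK// -rmorphXn; exact: state_contract.
Qed.

Lemma dual_bound_act a phi d : 0 <= d -> dual_bound (state_form w) phi d ->
  dual_bound (state_form w) (fun b => phi (star a * b)) (d * (cnorm (star a))%:C%C).
Proof.
move=> d0 hd b; rewrite (le_trans (hd _))// -mulrA ler_wpM2l//.
exact: state_form_contract.
Qed.

Lemma approximable_act a phi : approximable (state_form w) phi ->
  approximable (state_form w) (fun b => phi (star a * b)).
Proof.
move=> hphi e e0.
have c0 : 0 <= (cnorm (star a))%:C%C by rewrite lecR cnorm_ge0.
have c1 : 0 < (cnorm (star a))%:C%C + 1 by rewrite ltr_wpDl.
have d0 := divr_gt0 e0 c1.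
have [u hu] := hphi _ d0; exists (a * u).
have -> : (fun b => phi (star a * b)) - state_form w (a * u) =
    (fun b => (phi - state_form w u) (star a * b)).
  by apply/funext => b; rewrite !fctE /state_form starM starK !mulrA.
apply: (dual_bound_le hf _ (@dual_bound_act a _ _ (ltW d0) hu)).
by rewrite mulrAC ler_pdivrMr// ler_pM2l// lerDl.
Qed.

(** Vectors of [H] are antilinear functionals, so left multiplication by [a] becomes composition
    with its adjoint, left multiplication by [star a]. *)
Definition gns_rep (a : A) (x : H) : H :=
  completion_of hf (approximable_act a (completionP x)).

Definition gns_vector : H := completion_emb hf 1.

Lemma gns_rep_emb a u : gns_rep a (completion_emb hf u) = completion_emb hf (a * u).
Proof.
apply: val_inj; apply/funext => b /=.
by rewrite /state_form starM starK mulrA.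
Qed.

Lemma gns_rep_linear a : linear (gns_rep a).
Proof. by move=> c x y; apply: val_inj. Qed.

Lemma gns_rep_norm_le a x : `|gns_rep a x| <= `|x| * (cnorm (star a))%:C%C.
Proof.
have c0 : 0 <= (cnorm (star a))%:C%C by rewrite lecR cnorm_ge0.
apply: completion_sdnorm_le; first exact: mulr_ge0.
by apply: dual_bound_act => //; exact: completion_dual_bound.
Qed.

Lemma gns_rep_continuous a : continuous (gns_rep a).
Proof.
have c0 : 0 <= (cnorm (star a))%:C%C by rewrite lecR cnorm_ge0.
apply: (norm_le_continuous c0); [exact: gns_rep_linear|exact: gns_rep_norm_le].
Qed.

Lemma gns_rep_star_rep : is_star_rep gns_rep.
Proof.
split.
- by move=> a; split; [exact: gns_rep_linear|exact: gns_rep_continuous].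
- move=> c a b x; apply: val_inj; apply/funext => v.
  rewrite -[LHS]/(val x (star (c *: a + b) * v)) starD starZ mulrDl -scalerAl.
  by rewrite (approximable_antilinear hf (completionP x)) conjCK.
- by move=> x; apply: val_inj; apply/funext => v /=; rewrite star1 mul1r.
- by move=> a b x; apply: val_inj; apply/funext => v /=; rewrite starM mulrA.
(* If [f v] approximates [y], then the functional of [star a * v] approximates [gns_rep (star a) y],
   and [x] evaluated there is [gns_rep a x] evaluated at [v]. *)
move=> a x y.
have c1 : 0 < (cnorm (star (star a)))%:C%C + 1 by rewrite ltr_wpDl ?lecR ?cnorm_ge0.
apply: completion_dot_unique => e e0.
have [d d0 hd] := completion_dotP x (gns_rep (star a) y) e0.
have d10 := divr_gt0 d0 c1; exists (d / ((cnorm (star (star a)))%:C%C + 1)) => // v hv.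
apply: hd.
have -> : val (gns_rep (star a) y) - state_form w (star a * v) =
    (fun b => (val y - state_form w v) (star (star a) * b)).
  apply/funext => b.
  rewrite -[LHS]/(val y (star (star a) * b) - w (star b * (star a * v))).
  by rewrite mulrA -{1}(starK a) !starK -starM.
apply: (dual_bound_le hf _ (@dual_bound_act (star a) _ _ (ltW d10) hv)).
by rewrite mulrAC ler_pdivrMr// ler_pM2l// lerDl.
Qed.

Lemma gns_is_GNS : is_GNS w gns_rep gns_vector.
Proof.
split; first exact: gns_rep_star_rep.
  move=> O [x Ox] oO; have /nbhs_ballP[e /= e0 xe] : nbhs x O by exact: open_nbhs_nbhs.
  have e2 := divr_gt0 e0 (ltr0Sn R[i] 1).
  have [u hu] := completionP x e2; exists (completion_emb hf u); split; last first.
    by exists u => //; rewrite gns_rep_emb mulr1.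
  apply: xe; rewrite -ball_normE /=; apply: (@le_lt_trans _ _ (e / 2%:R)).
    by apply: completion_sdnorm_le; [exact: ltW|exact: hu].
  by rewrite ltr_pdivrMr// ltr_pMr// ltr1n.
move=> a; rewrite /gns_vector gns_rep_emb.
rewrite -[RHS]/(completion_dot _ _) completion_dot_emb /=.
by rewrite /state_form star1 mul1r mulr1.
Qed.

Lemma state_equiv_refl : state_equiv w w.
Proof.
exists H, gns_rep, gns_vector, H, gns_rep, gns_vector; split; try exact: gns_is_GNS.
exists id; split=> //.
by apply/seteqP; split=> // x _; exists x.
Qed.

End GNS.

(** * Functionals intertwining two geometric progressions *)

Section Functionals.
Variables (R : realType) (A : cstarAlgType R).
Implicit Types B : A -> R[i].

Definition bounded_functional B : Prop :=
  scalar B /\ exists M : R, forall a, `|B a| <= (M * cnorm a)%:C%C.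

Lemma cnorm_star_eq (a : A) : cnorm (star a) = cnorm a.
Proof.
have le (b : A) : cnorm b <= cnorm (star b).
  have [->|b0] := eqVneq (cnorm b) 0; first exact: cnorm_ge0.
  have b1 : 0 < cnorm b by rewrite lt_def b0 cnorm_ge0.
  by rewrite -(ler_pM2r b1) -expr2 -cnorm_star cnormM.
by apply/eqP; rewrite eq_le le -{2}(starK a) le.
Qed.

Section Linear.
Variable B : A -> R[i].
Hypothesis hB : scalar B.
Lemma functionalD a b : B (a + b) = B a + B b.
Proof. by have := hB 1 a b; rewrite /= scale1r mul1r. Qed.
Lemma functional0 : B 0 = 0.
Proof. by apply: (addrI (B 0)); rewrite -functionalD !addr0. Qed.
Lemma functionalZ c a : B (c *: a) = c * B a.
Proof. by have := hB c a 0; rewrite /= functional0 !addr0. Qed.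
Lemma functional_sum (I : Type) (r : seq I) (P : pred I) (F : I -> A) :
  B (\sum_(i <- r | P i) F i) = \sum_(i <- r | P i) B (F i).
Proof. exact: (big_morph B functionalD functional0). Qed.
End Linear.

(** Exchanges left and right multiplication, so that statements about one side transfer to the
    other. *)
Definition functional_star B : A -> R[i] := fun a => (B (star a))^*.

Lemma bounded_functional_star B :
  bounded_functional B -> bounded_functional (functional_star B).
Proof.
move=> [lB [M hM]]; split.
  by move=> c a b; rewrite /functional_star starD starZ lB rmorphD rmorphM /= conjCK.
by exists M => a; rewrite norm_conjC (le_trans (hM _))// cnorm_star_eq.
Qed.

Lemma bounded_functional_mull B (a : A) :
  bounded_functional B -> bounded_functional (fun x => B (a * x)).
Proof.
move=> [lB [M hM]]; split; first by move=> c x y; rewrite mulrDr -scalerAr lB.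
exists (`|M| * cnorm a) => x; rewrite (le_trans (hM _))// lecR -mulrA.
apply: (@le_trans _ _ (`|M| * cnorm (a * x))).
  by rewrite ler_wpM2r ?cnorm_ge0// ler_norm.
by rewrite ler_wpM2l// cnormM.
Qed.

Lemma bounded_functional_mulr B (a : A) :
  bounded_functional B -> bounded_functional (fun x => B (x * a)).
Proof.
move=> [lB [M hM]]; split; first by move=> c x y; rewrite mulrDl -scalerAl lB.
exists (`|M| * cnorm a) => x; rewrite (le_trans (hM _))// lecR mulrAC -mulrA.
apply: (@le_trans _ _ (`|M| * cnorm (x * a))).
  by rewrite ler_wpM2r ?cnorm_ge0// ler_norm.
by rewrite ler_wpM2l// cnormM.
Qed.

End Functionals.

(** * Reduced words determine bounded functionals *)

Section Words.
Variables (R : realType) (A : cstarAlgType R) (n : nat) (s : 'I_n -> A).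
Hypothesis hs : cuntz_relations s.
Implicit Types J K L : seq 'I_n.

Definition word J : A := foldr (fun i a => s i * a) 1 J.

Lemma word_cat J K : word (J ++ K) = word J * word K.
Proof. by elim: J => [|i J IH] /=; rewrite ?mul1r// IH mulrA. Qed.

(** Letters cancel from the inside until two of them differ, giving 0, or one word is used up. *)
Lemma starw_word K J : [\/ star (word K) * word J = 0,
  exists L, star (word K) * word J = word L |
  exists L, star (word K) * word J = star (word L)].
Proof.
elim: K J => [|i K IH] J; first by apply: Or32; exists J; rewrite star1 mul1r.
case: J => [|j J]; first by apply: Or33; exists (i :: K); rewrite mulr1.
rewrite /= starM mulrA -(mulrA (star (word K))) hs.1.
case: (i == j); first by rewrite mulr1.
by apply: Or31; rewrite mulr0 mul0r.
Qed.

(* The common zeros of all bounded functionals vanishing on the reduced words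
   form a closed star-subalgebra, because left and right translates of such
   functionals are again of this kind. *)
Lemma bounded_functional_words_eq0 (B : A -> R[i]) :
    cstar_generated s -> bounded_functional B ->
    (forall J K, B (word J * star (word K)) = 0) ->
  forall a, B a = 0.
Proof.
move=> gen hB B0.
pose vanishing (phi : A -> R[i]) := bounded_functional phi /\
  forall J K, phi (word J * star (word K)) = 0.
pose S := [set a | forall phi, vanishing phi -> phi a = 0].
suff ST : S = setT.
  by move=> a; suff Sa : S a by [exact: (Sa B (conj hB B0))]; rewrite ST.
apply: gen.
- split.
  + by move=> phi [_ /(_ [::] [::])]; rewrite /= star1 mulr1.
  + by move=> a b Sa Sb phi hp; rewrite (functionalD hp.1.1) Sa// Sb// addr0.
  + move=> a b Sa Sb phi [bp p0]; apply: (Sa (fun x => phi (x * b))).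
    split; first exact: bounded_functional_mulr.
    move=> J K; apply: (Sb (fun x => phi (word J * star (word K) * x))).
    split; first exact: bounded_functional_mull.
    move=> J' K'; rewrite -mulrA (mulrA (star _)).
    have [->|[L ->]|[L ->]] := starw_word K J'.
    * by rewrite mul0r mulr0 (functional0 bp.1).
    * by rewrite mulrA -word_cat p0.
    * by rewrite -starM -word_cat p0.
  + by move=> c a Sa phi hp; rewrite (functionalZ hp.1.1) Sa// mulr0.
  + move=> a Sa phi [bp p0]; apply: (inv_inj conjCK); rewrite conjC0.
    apply: (Sa (functional_star phi)); split; first exact: bounded_functional_star.
    by move=> J K; rewrite /functional_star starM starK p0 conjC0.
- move=> a ha phi hp; have [[lp [M hM]] _] := hp.
  apply: (@le_eps_eq0 _ (`|M| )%:C%C); first by rewrite lecR.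
  move=> e e0.
  have eE : e = (complex.Re e)%:C%C by rewrite RRe_real// gtr0_real.
  have [|b Sb ab] := ha (complex.Re e); first by rewrite -ltcR -eE.
  rewrite -(subrK b a) (functionalD lp) (Sb phi)// addr0 (le_trans (hM _))//.
  rewrite eE -rmorphM lecR (le_trans (ler_wpM2r (cnorm_ge0 _) (ler_norm M)))//.
  by rewrite mulrC ler_wpM2r// ltW.
- by move=> i phi [_ /(_ [:: i] [::])]; rewrite /= star1 !mulr1.
Qed.

End Words.

(** * Vanishing of intertwining functionals *)

Section Intertwiner.
Variables (R : realType) (A : cstarAlgType R) (n : nat) (s : 'I_n -> A).
Hypothesis hs : cuntz_relations s.
Variables (o : 'I_n) (k : nat).
Hypothesis k0 : (0 < k)%N.
Local Notation N := (s o).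

(** For [B a = <a Omega, Omega'>], the first two clauses express that [Omega] is an eigenvector of
    the adjoints of the isometries with eigenvalues from [z], the last two the same for [Omega'] and
    [y]. *)
Definition intertwines (z : nat -> 'I_n -> R[i]) (zk : R[i])
    (y : nat -> 'I_n -> R[i]) (yk : R[i]) (B : A -> R[i]) : Prop :=
  [/\ forall a r i, (r < k)%N -> i != o -> B (a * star (N ^+ r * s i)) = z r i * B a,
      forall a, B (a * star (N ^+ k)) = zk * B a,
      forall a r i, (r < k)%N -> i != o -> B (N ^+ r * s i * a) = (y r i)^* * B a
    & forall a, B (N ^+ k * a) = yk^* * B a].

Lemma intertwines_star z zk y yk B : intertwines z zk y yk B ->
  intertwines y yk z zk (functional_star B).
Proof.
move=> [h1 h2 h3 h4]; split=> [a r i rk io|a|a r i rk io|a];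
  rewrite /functional_star starM ?starK.
- by rewrite h3// rmorphM /= conjCK.
- by rewrite h4 rmorphM /= conjCK.
- by rewrite h1// rmorphM.
- by rewrite h2 rmorphM.
Qed.

Section Vanishing.
Variables (z y : nat -> 'I_n -> R[i]) (zk yk : R[i]) (B : A -> R[i]).
Hypotheses (lB : scalar B) (hB : intertwines z zk y yk B).

(** Each [N ^+ k] removed on the left costs only a scalar. Once the exponent is below [k],
    [N ^+ r * s i] is one of the isometries of the progression and comes out as a scalar too. *)
Lemma intertwines_pow_gen r i a : i != o -> B a = 0 -> B (N ^+ r * s i * a) = 0.
Proof.
move=> io Ba; have [_ _ h3 h4] := hB.
have [m] := ubnP r; elim: m r => // m IH r rm.
have [rk|kr] := ltnP r k; first by rewrite h3// Ba mulr0.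
rewrite -(subnKC kr) exprD -!mulrA h4 mulrA IH ?mulr0//.
lia.
Qed.

(** A letter [o] is absorbed into the power of [N], which is why the hypothesis ranges over all [r];
    any other letter is removed by [intertwines_pow_gen]. *)
Lemma intertwines_word J x : (forall r, B (N ^+ r * x) = 0) ->
  forall r, B (N ^+ r * (word s J * x)) = 0.
Proof.
move=> hx; elim: J => [|i J IH] r /=; first by rewrite mul1r.
have [->|io] := eqVneq i o; first by rewrite !mulrA -exprSr -mulrA.
by rewrite -!mulrA mulrA intertwines_pow_gen// -[X in B X]mul1r (IH 0).
Qed.

Hypothesis B1 : B 1 = 0.

(* Insert 1 = \sum_i s_i s_i^*; the terms with i <> o vanish. *)
Lemma intertwines_shift m p : (p < k)%N ->
  B (N ^+ m * star (N ^+ p)) = B (N ^+ m.+1 * star (N ^+ p.+1)).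
Proof.
move=> pk; have [h1 _ _ _] := hB.
rewrite -[star (N ^+ p)]mul1r -hs.2 (bigD1 o)//= mulrDl mulrDr functionalD//.
rewrite exprSr exprSr starM !mulrA -[RHS]addr0; congr (_ + _).
rewrite mulr_sumr mulr_suml functional_sum// big1// => i io.
by rewrite !mulrA -mulrA -starM h1// -[_ * s i]mulr1 intertwines_pow_gen ?mulr0.
Qed.

Hypothesis zyk : zk * yk^* != 1.

Lemma intertwines_pow r : B (N ^+ r) = 0.
Proof.
have [_ h2 _ h4] := hB.
have H p : (p <= k)%N -> B (N ^+ r) = B (N ^+ (r + p) * star (N ^+ p)).
  elim: p => [|p IH] pk; first by rewrite addn0 star1 mulr1.
  by rewrite IH ?(ltnW pk)// intertwines_shift// addnS.
have := H k (leqnn k); rewrite h2 addnC exprD h4 mulrA => /eqP.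
rewrite -subr_eq0 -[X in X - _]mul1r -mulrBl mulf_eq0 subr_eq0 eq_sym (negbTE zyk).
by move/eqP.
Qed.

End Vanishing.

Lemma intertwines_eq0 z y zk yk B : cstar_generated s -> bounded_functional B ->
  intertwines z zk y yk B -> B 1 = 0 -> zk * yk^* != 1 -> forall a, B a = 0.
Proof.
move=> gen bB hB B1 zyk; apply: (bounded_functional_words_eq0 hs) => //.
have [lB _] := bB; have [lB' _] := bounded_functional_star bB.
have hB' := intertwines_star hB.
have B'1 : functional_star B 1 = 0 by rewrite /functional_star star1 B1 conjC0.
have zyk' : yk * zk^* != 1.
  by apply: contra zyk => /eqP/(congr1 (@Num.conj _)); rewrite rmorphM rmorph1 /= conjCK mulrC => ->.
have B'E a : functional_star B a = 0 -> B (star a) = 0.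
  by move=> /eqP; rewrite conjC_eq0 => /eqP.
(* Induction on [q]: while [q >= k], a factor [star (N ^+ k)] comes out as a scalar; below [k], one
   [N] is cancelled on each side by [intertwines_shift]. If the left power is exhausted first, the
   adjoint functional takes over. *)
have BN r q : B (N ^+ r * star (N ^+ q)) = 0.
  have [m] := ubnP q; elim: m q r => // m IH q r qm.
  have [kq|qk] := leqP k q.
    have [_ h2 _ _] := hB; rewrite -(subnKC kq) exprD starM mulrA h2 IH ?mulr0//.
    lia.
  case: q qm qk => [|q] qm qk; first by rewrite star1 mulr1 (intertwines_pow lB hB).
  case: r => [|r]; last by rewrite -(intertwines_shift lB hB)// ?(ltnW qk)// IH.
  by rewrite mul1r B'E// (intertwines_pow lB' hB').
(* First [word s J] is stripped on the left, then [word s K] in the same way through the adjoint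
   functional. *)
have BJ J q : B (word s J * star (N ^+ q)) = 0.
  by rewrite -[X in B X]mul1r (intertwines_word hB _ _ 0)// => r; exact: BN.
move=> J K; rewrite -[_ * _]starK B'E// starM starK -[X in functional_star _ X]mul1r.
apply: (intertwines_word hB' _ _ 0) => r.
by rewrite /functional_star starM starK BJ conjC0.
Qed.

End Intertwiner.

(** * Geometric progression states *)

(** One-based positions are [q * r + i] with [1 <= i <= q] in block [r], followed by one last
    position; [block_lt] keeps the blocks disjoint. *)
Lemma big_ord_blocks (V : nmodType) (F : nat -> V) q k :
  \sum_(j < q * k + 1) F j.+1 =
  \sum_(0 <= r < k) \sum_(1 <= i < q.+1) F (q * r + i)%N + F (q * k + 1)%N.
Proof.
rewrite addn1 big_ord_recr /=; congr (_ + _).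
rewrite -(big_mkord xpredT (fun j => F j.+1)) mulnC big_nat_mul.
apply: eq_bigr => r _; rewrite big_add1 /=.
rewrite -{1}(add0n (r * q)%N) mulSn big_addn addnK.
by apply: eq_bigr => i _; rewrite addnS addnC mulnC.
Qed.

Lemma block_lt q r r' i : (r < r')%N -> (i <= q)%N -> (q * r + i <= q * r')%N.
Proof.
move=> rr' iq; have : (q * r.+1 <= q * r')%N by rewrite leq_mul2l rr' orbT.
by rewrite mulnS; lia.
Qed.

Section Entries.
Variable R : realType.
Local Notation C := R[i].

Lemma ent_ord (V : nmodType) m (x : 'I_m -> V) (i : 'I_m) : ent x i.+1 = x i.
Proof. by rewrite /ent /= valK. Qed.

Lemma centry_gp_vec m k l (z : 'rV[C]_m) j : (1 <= j <= l)%N ->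
  centry (gp_vec k l z) j =
    \sum_(0 <= r < k) \sum_(1 <= i < m)
      (centry z m ^+ r * centry z i) * (j == m.-1 * r + i)%:R
    + centry z m ^+ k * (j == l)%:R.
Proof.
case/andP=> j1 jl; have jl' : (j.-1 < l)%N by lia.
rewrite -(prednK j1) /centry (ent_ord _ (Ordinal jl')) prednK//.
rewrite !mxE summxE; congr (_ + _); last by rewrite /= prednK.
apply: eq_bigr => r _; rewrite summxE; apply: eq_bigr => i _.
by rewrite !mxE /= prednK.
Qed.

Lemma gp_vec_block q k (z : 'rV[C]_q.+1) r i : (r < k)%N -> (1 <= i <= q)%N ->
  centry (gp_vec k (q * k + 1) z) (q * r + i) = centry z q.+1 ^+ r * centry z i.
Proof.
move=> rk /andP[i1 iq]; have jl := block_lt rk iq.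
rewrite centry_gp_vec /=; last by lia.
rewrite (_ : (_ == q * k + 1)%N = false) ?mulr0 ?addr0; last by lia.
rewrite big_mkord (bigD1 (Ordinal rk))//= (bigD1_seq i) ?iota_uniq//=; last first.
  by rewrite mem_index_iota i1.
rewrite eqxx mulr1 !big1 ?addr0// => [r' rr'|i' /negPf ii'].
  rewrite big_seq big1// => i'; rewrite mem_index_iota => /andP[i'1 i'q].
  case: eqP => [e|_]; last by rewrite mulr0.
  case/eqP: rr'; apply: val_inj => /=.
  have [rr'|rr'|//] := ltngtP r' r.
    by have := @block_lt q _ _ i' rr' i'q; lia.
  by have := block_lt rr' iq; lia.
by rewrite eqn_add2l eq_sym ii' mulr0.
Qed.

Lemma gp_vec_last q k (z : 'rV[C]_q.+1) :
  centry (gp_vec k (q * k + 1) z) (q * k + 1) = centry z q.+1 ^+ k.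
Proof.
rewrite centry_gp_vec; last by lia.
rewrite eqxx mulr1 big_nat big1 ?add0r// => r rk.
rewrite big_nat big1// => i /andP[_ iq].
by rewrite (_ : (_ == _) = false) ?mulr0//; have := @block_lt q _ _ i rk iq; lia.
Qed.

Lemma unit_sphere_blocks q k (z : 'rV[C]_(q * k + 1)) : unit_sphere z <->
  \sum_(0 <= r < k) \sum_(1 <= i < q.+1) `|centry z (q * r + i)| ^+ 2 +
    `|centry z (q * k + 1)| ^+ 2 = 1.
Proof.
rewrite -(big_ord_blocks (fun j => `|centry z j| ^+ 2)).
by rewrite /unit_sphere /=; under [X in _ <-> X = _]eq_bigr do rewrite /centry ent_ord.
Qed.

Lemma unit_sphere_last_le m (z : 'rV[C]_m.+1) : unit_sphere z -> `|centry z m.+1| <= 1.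
Proof.
move=> hz; rewrite -(@expr_le1 _ 2)// -hz big_ord_recr/= /centry (ent_ord _ ord_max).
by rewrite lerDr sumr_ge0// => i _; rewrite exprn_ge0.
Qed.

(** With [u] the modulus of the last entry, block [r] contributes [u^(2r) (1 - u^2)]. The sum
    telescopes to [1 - u^(2k)], and the last entry supplies [u^(2k)]. *)
Lemma unit_sphere_gp_vec q k (z : 'rV[C]_q.+1) : unit_sphere z ->
  unit_sphere (gp_vec k (q * k + 1) z).
Proof.
move=> hz; apply/unit_sphere_blocks.
have z1 : \sum_(1 <= i < q.+1) `|centry z i| ^+ 2 = 1 - `|centry z q.+1| ^+ 2.
  apply/eqP; rewrite eq_sym subr_eq -hz; apply/eqP.
  rewrite big_ord_recr /= /centry (ent_ord _ ord_max); congr (_ + _).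
  rewrite big_add1 big_mkord; apply: eq_bigr => i _.
  by rewrite -(ent_ord (z 0) (widen_ord _ i)).
rewrite gp_vec_last normrX.
set u := `|centry z q.+1| in z1 *.
rewrite (eq_big_nat _ _ (F2 := fun r => (u ^+ 2) ^+ r * (1 - u ^+ 2))).
  rewrite -mulr_suml -exprM mulnC exprM; move: (u ^+ 2) => v.
  elim: k => [|k IH]; first by rewrite big_geq// mul0r add0r expr0.
  by rewrite big_nat_recr//= exprS -[RHS]IH; ring.
move=> r /andP[_ rk]; rewrite -z1 mulr_sumr; apply: eq_big_nat => i im.
by rewrite gp_vec_block// normrM normrX exprMn exprAC.
Qed.

End Entries.

(** * Eigenvector relations expressed by a state *)

Section StarEigen.
Variables (R : realType) (A : cstarAlgType R) (w : A -> R[i]).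
Hypothesis hw : is_state w.

Lemma state_ge0 a : 0 <= w (star a * a). Proof. by case: hw. Qed.

(* In the GNS representation this says that t^* Omega = c Omega. *)
Definition star_eigen (t : A) (c : R[i]) : Prop :=
  w (star (star t - c *: 1) * (star t - c *: 1)) = 0.

(** The left side is the squared length of [t^* Omega - c Omega]; the formula reduces [star_eigen]
    to an equality of numbers that can be summed over the isometries. *)
Lemma star_eigen_gap t c : w t = c^* ->
  w (star (star t - c *: 1) * (star t - c *: 1)) = w (t * star t) - `|c| ^+ 2.
Proof.
move=> wt; rewrite starB starK starZ star1 mulrBl !mulrBr.
rewrite -!scalerAl -!scalerAr !mul1r mulr1.
rewrite !(stateB hw) !(stateZ hw) (state1 hw) (state_star hw) wt conjCK normCK; ring.
Qed.

(** Cauchy-Schwarz: a vector of seminorm zero pairs to zero with every [star a]. *)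
Lemma star_eigen_mulr t c a : star_eigen t c -> w (a * star t) = c * w a.
Proof.
move=> h; have := semi_dot_CauchySchwarz (state_form_semi_dot hw) (star t - c *: 1) (star a).
rewrite /state_form h mul0r starK => h0; apply/eqP; rewrite -subr_eq0.
rewrite -(stateZ hw) -(stateB hw) -[c *: a]mulr1 -scalerAl scalerAr -mulrBr.
by rewrite -normr_eq0 -sqrf_eq0 eq_le h0 exprn_ge0.
Qed.

Lemma star_eigen_mull t c a : star_eigen t c -> w (t * a) = c^* * w a.
Proof.
move=> h; apply: (inv_inj conjCK).
by rewrite -(state_star hw) starM (star_eigen_mulr _ h) (state_star hw) rmorphM /= conjCK.
Qed.

Lemma star_eigen_val t c : star_eigen t c -> w t = c^*.
Proof. by move=> h; rewrite -[t]mulr1 (star_eigen_mull _ h) (state1 hw) mulr1. Qed.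

Lemma star_eigenX t c r a : star_eigen t c -> w (t ^+ r * a) = (c^*) ^+ r * w a.
Proof.
move=> h; elim: r => [|r IH]; first by rewrite !expr0 !mul1r.
by rewrite exprS -mulrA (star_eigen_mull _ h) IH exprS mulrA.
Qed.

End StarEigen.

Section GPStates.
Variables (R : realType) (A : cstarAlgType R) (q : nat) (s : 'I_q.+1 -> A).
Hypotheses (hs : cuntz_relations s) (q0 : (0 < q)%N).
Local Notation N := (ent s q.+1).

(** Inserting the Cuntz relation between [N ^+ k] and [star (N ^+ k)] splits the last projection
    into block [k] and the next power. *)
Lemma cuntz_blocks k :
  \sum_(0 <= r < k) \sum_(1 <= i < q.+1) (N ^+ r * ent s i) * star (N ^+ r * ent s i)
    + N ^+ k * star (N ^+ k) = 1.
Proof.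
elim: k => [|k IH]; first by rewrite big_geq// add0r star1 mulr1.
rewrite big_nat_recr//= -[RHS]IH -addrA; congr (_ + _).
rewrite exprSr.
transitivity (N ^+ k * (\sum_(1 <= i < q.+1) ent s i * star (ent s i) + N * star N) * star (N ^+ k)).
  rewrite mulrDr mulrDl mulr_sumr mulr_suml starM !mulrA; congr (_ + _).
  by apply: eq_bigr => i _; rewrite starM !mulrA.
rewrite [X in _ * X * _](_ : _ = 1) ?mulr1// -hs.2 big_ord_recr/=.
rewrite (ent_ord s ord_max); congr (_ + _).
by rewrite big_add1 big_mkord; apply: eq_bigr => i _; rewrite (ent_ord s (widen_ord _ i)).
Qed.

Lemma gp_order k : ((q * k + 1).-1 %/ q.+1.-1)%N = k.
Proof. by rewrite addn1 /= mulKn. Qed.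

(* The numbers w (t t^* ) - |c|^2 are nonnegative and their sum over the
   isometries t is 1 - 1 = 0. *)
Lemma gp_state_star_eigen k (z : 'rV[R[i]]_(q * k + 1)) (w : A -> R[i]) :
  unit_sphere z -> is_gp_state s z w ->
  (forall r i, (r < k)%N -> (1 <= i <= q)%N ->
    star_eigen w (N ^+ r * ent s i) (centry z (q * r + i))) /\
  star_eigen w (N ^+ k) (centry z (q * k + 1)).
Proof.
move=> hz [hw]; rewrite gp_order /= => hri hk.
pose F r i := w (star (star (N ^+ r * ent s i) - centry z (q * r + i) *: 1) *
  (star (N ^+ r * ent s i) - centry z (q * r + i) *: 1)).
pose G := w (star (star (N ^+ k) - centry z (q * k + 1) *: 1) *
  (star (N ^+ k) - centry z (q * k + 1) *: 1)).
have F0 r i : 0 <= F r i by exact: state_ge0.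
have G0 : 0 <= G by exact: state_ge0.
have S0 : \sum_(0 <= r < k) \sum_(1 <= i < q.+1) F r i + G = 0.
  have := congr1 w (cuntz_blocks k); rewrite (stateD hw) (state_sum hw) (state1 hw).
  move: hz => /unit_sphere_blocks <- e.
  rewrite /G (star_eigen_gap hw hk); apply: (linear_combination e).
  rewrite subr0 opprD addrACA -sumrB; congr (_ + _); apply: eq_big_nat => r /andP[_ rk].
  rewrite (state_sum hw) -sumrB; apply: eq_big_nat => i iq.
  by rewrite /F star_eigen_gap// hri.
have sF0 r : 0 <= \sum_(1 <= i < q.+1) F r i by exact: sumr_ge0.
have [sF G00] : \sum_(0 <= r < k) \sum_(1 <= i < q.+1) F r i = 0 /\ G = 0.
  have h : 0 <= \sum_(0 <= r < k) \sum_(1 <= i < q.+1) F r i.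
    by apply: sumr_ge0 => r _; exact: sF0.
  by move/eqP: S0; rewrite paddr_eq0// => /andP[/eqP ? /eqP ?].
split=> // r i rk iq; move/eqP: sF; rewrite psumr_eq0// => /allP/(_ r).
rewrite mem_index_iota => /(_ rk) /=; rewrite psumr_eq0// => /allP/(_ i).
by rewrite mem_index_iota => /(_ iq) /= /eqP.
Qed.

(** Write [r = a (r / a) + r mod a]. Then [N^r s_i] is a power of [N^a] times an isometry of the old
    progression, and both factors act by known eigenvalues. *)
Lemma gp_state_gp_vec a k m l (z : 'rV[R[i]]_m) (w : A -> R[i]) :
    m = (q * a + 1)%N -> l = (q * (a * k) + 1)%N -> (0 < a)%N -> unit_sphere z ->
  is_gp_state s z w -> is_gp_state s (gp_vec k l z) w.
Proof.
move=> mE lE a0 hz hw; subst m l.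
have [w_state _ _] := hw; have [eri ek] := gp_state_star_eigen hz hw.
(* The length is turned into a successor, the form in which the entries of [gp_vec] are computed. *)
move: (q * a + 1)%N (addn1 (q * a)) z hz hw eri ek => m mE.
subst m => z hz hw eri ek; rewrite mulnA.
split=> //; rewrite -?mulnA gp_order /=.
  move=> r i rak iq; rewrite mulnA.
  have pa : (r %% a < a)%N by rewrite ltn_mod.
  rewrite {1 2}(divn_eq r a) mulnC exprD exprM -mulrA (star_eigenX _ _ _ ek)//.
  rewrite (star_eigen_val _ (eri _ _ pa iq))// mulnDr mulnA -addnA.
  rewrite gp_vec_block.
  - by rewrite rmorphM rmorphXn.
  - by rewrite ltn_divLR// mulnC.
  - by case/andP: iq => i0 iq; rewrite (@block_lt q _ _ i pa iq) andbT addn_gt0 i0 orbT.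
rewrite mulnA gp_vec_last rmorphXn exprM -[X in w X]mulr1 (star_eigenX _ _ _ ek)//.
by rewrite state1// mulr1.
Qed.

Let o : 'I_q.+1 := ord_max.

(** Ordinals start at 0 and entries at 1, hence [i.+1]. *)
Definition gp_coef m (z : 'rV[R[i]]_m) (r : nat) (i : 'I_q.+1) := centry z (q * r + i.+1)%N.

Lemma gp_state_unique k m (z : 'rV[R[i]]_m) (w w' : A -> R[i]) :
  cstar_generated s -> m = (q * k + 1)%N -> (0 < k)%N -> Wset z ->
  is_gp_state s z w -> is_gp_state s z w' -> w = w'.
Proof.
move=> gen mE k0 [hz z1] hw hw'; subst m.
have [sw _ _] := hw; have [sw' _ _] := hw'.
have [eri ek] := gp_state_star_eigen hz hw.
have [eri' ek'] := gp_state_star_eigen hz hw'.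
apply/funext => x; apply/eqP; rewrite -subr_eq0; apply/eqP.
have bnd u : is_state u -> forall b, `|u b| <= (cnorm b)%:C%C by move=> ?; exact: state_norm_le.
have NE : s o = N by rewrite -(ent_ord s o).
apply: (@intertwines_eq0 _ _ _ _ hs o k k0 (gp_coef z) (gp_coef z)
  (centry z (q * k + 1)) (centry z (q * k + 1)) (fun b => w b - w' b)) => //.
- split; first by move=> c a b; rewrite !(state_scalar sw, state_scalar sw'); ring.
  exists 2%:R => b; rewrite (le_trans (ler_normB _ _))//.
  by rewrite mulr_natl mulr2n rmorphD lerD// bnd.
- have iq i : i != o -> (1 <= i.+1 <= q)%N.
    by move=> io; have := ltn_ord i; have : (i : nat) != q by []; lia.
  rewrite /gp_coef; split=> [a r i rk /iq io|a|a r i rk /iq io|a]; rewrite NE -?(ent_ord s i).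
  + by rewrite (star_eigen_mulr sw _ (eri _ _ rk io)) (star_eigen_mulr sw' _ (eri' _ _ rk io)) mulrBr.
  + by rewrite (star_eigen_mulr sw _ ek) (star_eigen_mulr sw' _ ek') mulrBr.
  + by rewrite (star_eigen_mull sw _ (eri _ _ rk io)) (star_eigen_mull sw' _ (eri' _ _ rk io)) mulrBr.
  + by rewrite (star_eigen_mull sw _ ek) (star_eigen_mull sw' _ ek') mulrBr.
- by rewrite !state1// subrr.
(* Here the product of last entries is the squared modulus of [z_m], which is below 1 on [Wset]. *)
- by rewrite -normCK lt_eqF// expr_lt1.
Qed.

End GPStates.

(** * Vectors and functionals in a star-representation *)

Section HilbertFacts.
Variables (R : realType) (H : hilbertType R).

Lemma hilbert_semi_dot : semi_dot (fun x y : H => hdot x y).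
Proof.
split=> [v c x y|u v|v].
- by rewrite linearDl linearZl_LR.
- by rewrite (hermitian_subproof (s := hdot)) expr0 mul1r.
- by rewrite hdotE exprn_ge0.
Qed.

Lemma hdot_norm_le (x y : H) : `|hdot x y| <= `|x| * `|y|.
Proof.
have := semi_dot_norm_le hilbert_semi_dot x y.
by rewrite /sdnorm !hdotE !sqrCK.
Qed.

Lemma hdot_eq0 (x : H) : hdot x x = 0 -> x = 0.
Proof. by rewrite hdotE => /eqP; rewrite sqrf_eq0 normr_eq0 => /eqP. Qed.

Variables (A : cstarAlgType R) (pi : A -> H -> H).
Hypothesis hpi : is_star_rep pi.

Lemma star_repD a b x : pi (a + b) x = pi a x + pi b x.
Proof. by have [_ h _ _ _] := hpi; have := h 1 a b x; rewrite !scale1r. Qed.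

Lemma star_rep0 x : pi 0 x = 0.
Proof. by apply: (addrI (pi 0 x)); rewrite -star_repD !addr0. Qed.

Lemma star_repZ c a x : pi (c *: a) x = c *: pi a x.
Proof. by have [_ h _ _ _] := hpi; have := h c a 0 x; rewrite star_rep0 !addr0. Qed.

Lemma star_rep_vec a c x : pi a (c *: x) = c *: pi a x.
Proof.
have [h _ _ _ _] := hpi; have [lin _] := h a.
have p0 : pi a 0 = 0.
  by have := lin (-1) 0 0; rewrite scaler0 addr0 scaleN1r addNr.
by have := lin c x 0; rewrite p0 !addr0.
Qed.

Lemma hdot_rep a b x y : hdot (pi a x) (pi b y) = hdot (pi (star b * a) x) y.
Proof.
have [_ _ _ hM hst] := hpi.
by rewrite hM [RHS]hst starK.
Qed.

Lemma star_rep_eigen (w : A -> R[i]) (Omega : H) t c :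
  (forall a, w a = hdot (pi a Omega) Omega) -> star_eigen w t c ->
  pi (star t) Omega = c *: Omega.
Proof.
move=> hw; have [_ _ h1 _ _] := hpi.
rewrite /star_eigen hw -hdot_rep => /hdot_eq0.
rewrite star_repD -scaleNr star_repZ h1 scaleNr => /eqP.
by rewrite subr_eq0 => /eqP.
Qed.

(** The bound comes from the state: the squared norm of [pi a Omega] is [w (star a * a)], at most
    [cnorm a ^+ 2]. *)
Lemma star_rep_functional (Omega Omega' : H) (w : A -> R[i]) :
  is_state w -> (forall a, w a = hdot (pi a Omega) Omega) ->
  bounded_functional (fun a => hdot (pi a Omega) Omega').
Proof.
move=> sw hw; have [_ hlin _ _ _] := hpi; split.
  by move=> c a b; rewrite hlin linearDl linearZl_LR.
exists (complex.Re `|Omega'|) => a.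
have oE : (complex.Re `|Omega'|)%:C%C = `|Omega'| by rewrite RRe_real// normr_real.
rewrite (le_trans (hdot_norm_le _ _))// mulrC rmorphM /= oE ler_wpM2l//.
rewrite -(@ler_pXn2r _ 2)// ?nnegrE ?lecR ?cnorm_ge0//.
rewrite -hdotE hdot_rep -hw -rmorphXn /= -cnorm_star.
rewrite -(ger0_norm (state_ge0 sw a)); exact: state_norm_le.
Qed.

End HilbertFacts.

(** * Equivalent states of the same order *)

Section Equivalence.
Variables (R : realType) (A : cstarAlgType R) (q : nat) (s : 'I_q.+1 -> A).
Hypotheses (hs : cuntz_relations s) (gen : cstar_generated s) (q0 : (0 < q)%N).
Local Notation N := (ent s q.+1).

(** For [y] it suffices to be a unit vector, since [|z_m| < 1] and [|y_m| <= 1] already keep [z_m]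
    times the conjugate of [y_m] away from 1. In the comparison with a Cuntz state, no strict bound
    on the last entry is available beforehand. *)
Lemma gp_state_equiv_eq k m (z y : 'rV[R[i]]_m) (w w' : A -> R[i]) :
    m = (q * k + 1)%N -> (0 < k)%N -> Wset z -> unit_sphere y ->
  is_gp_state s z w -> is_gp_state s y w' -> state_equiv w w' -> z = y.
Proof.
move=> mE k0 [hz z1] hy hw hw'; subst m.
have [sw _ _] := hw; have [sw' _ _] := hw'.
have [eri ek] := gp_state_star_eigen hs q0 hz hw.
have [eri' ek'] := gp_state_star_eigen hs q0 hy hw'.
case=> H [rho [v [H' [rho' [v' [[rep dns wE] [_ _ wE'] [U [_ Udot Usurj Upi]]]]]]]].
(* Pull the second cyclic vector back along [U], so that both states are vector states of [rho]. *)
have [Psi UPsi] : exists x, U x = v' by have : range U v' by [rewrite Usurj]; case=> x _ <-; exists x.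
have {}wE' a : w' a = hdot (rho a Psi) Psi by rewrite wE' -UPsi -Upi Udot.
pose B a := hdot (rho a v) Psi.
have [_ _ rep1 repM repst] := rep.
have Br t c a : star_eigen w t c -> B (a * star t) = c * B a.
  by move=> h; rewrite /B repM (star_rep_eigen rep wE h) star_rep_vec// linearZl_LR.
have Bl t c a : star_eigen w' t c -> B (t * a) = c^* * B a.
  by move=> h; rewrite /B repM repst (star_rep_eigen rep wE' h) linearZr_LR.
have bB : bounded_functional B := star_rep_functional rep Psi sw wE.
have [lB _] := bB.
apply: contrapT => /eqP zy.
pose F j := centry z j * (centry y j)^*.
have B1E : B 1 = (\sum_(j < q * k + 1) F j.+1) * B 1.
  rewrite big_ord_blocks mulrDl mulr_suml -[in LHS](cuntz_blocks hs k).
  rewrite (functionalD lB) (functional_sum lB); congr (_ + _).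
    apply: eq_big_nat => r /andP[_ rk]; rewrite mulr_suml (functional_sum lB).
    apply: eq_big_nat => i iq.
    by rewrite (Br _ _ _ (eri _ _ rk iq)) -[_ * ent s i]mulr1 (Bl _ _ _ (eri' _ _ rk iq)) mulrA.
  by rewrite (Br _ _ _ ek) -[N ^+ k]mulr1 (Bl _ _ _ ek') mulrA.
(* B 1 = <z, y> B 1, and <z, y> = 1 forces z = y for unit vectors. *)
have B1 : B 1 = 0.
  apply/eqP/negPn/negP => B10; case/eqP: zy.
  have F1 : \sum_(j < q * k + 1) F j.+1 = 1 by apply: (mulIf B10); rewrite -B1E mul1r.
  apply/rowP => j; apply/eqP; rewrite -subr_eq0 -normr_eq0 -sqrf_eq0.
  have S0 : \sum_(j < q * k + 1) `|z 0 j - y 0 j| ^+ 2 = 0.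
    (* The squared distance of [z] and [y] is 2 minus twice the real part of [<z, y>], hence 0. *)
    transitivity (\sum_(j < q * k + 1) ((`|z 0 j| ^+ 2 + `|y 0 j| ^+ 2) - (F j.+1 + (F j.+1)^*))).
      apply: eq_bigr => i _; rewrite /F /centry !ent_ord rmorphM /= conjCK.
      by rewrite !normCK rmorphB; ring.
    rewrite sumrB !big_split /= hz hy -(big_morph _ (rmorphD (@Num.conj R[i])) (rmorph0 _)).
    by rewrite F1 rmorph1 subrr.
  by move/eqP: S0; rewrite psumr_eq0 => [/allP/(_ j)|//]; rewrite mem_index_enum => /(_ isT).
have NE : s ord_max = N by rewrite -(ent_ord s ord_max).
have BE : forall a, B a = 0.
  apply: (@intertwines_eq0 _ _ _ _ hs ord_max k k0 (gp_coef z) (gp_coef y)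
    (centry z (q * k + 1)) (centry y (q * k + 1))) => //.
    have iq (i : 'I_q.+1) : i != ord_max -> (1 <= i.+1 <= q)%N.
      by move=> io; have := ltn_ord i; have : (i : nat) != q by [exact: io]; lia.
    split=> [a r i rk /iq io|a|a r i rk /iq io|a]; rewrite NE -?(ent_ord s i).
    + exact: Br (eri _ _ rk io).
    + exact: Br.
    + exact: Bl (eri' _ _ rk io).
    + exact: Bl.
  have y1 : `|centry y (q * k + 1)| <= 1.
    by move: (q * k + 1)%N (addn1 (q * k)) y hy {zy F B1E B1 Bl eri' ek' hw'} => l lE; subst l => y; exact: unit_sphere_last_le.
  apply: contraTneq z1 => /(congr1 Num.norm); rewrite normr1 normrM norm_conjC => zy1.
  by rewrite -real_leNgt ?normr_real// -zy1 ler_piMr.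
have Psi0 : Psi = 0.
  apply/eqP/negPn/negP; rewrite -normr_gt0 => P0.
  (* The ball around [Psi] of radius [|Psi|] meets the dense orbit of [v] in some [u], which is
     orthogonal to [Psi] because [B] vanishes. Then [|Psi|^2 = <Psi - u, Psi>] is strictly below
     [|Psi|^2], a contradiction. *)
  have [|u [Pu [a _ uE]]] := dns (ball Psi `|Psi|) _ (ball_open _ _).
    by exists Psi; exact: ballxx.
  move: Pu; rewrite -ball_normE /= => Pu.
  have := hdot_norm_le (Psi - u) Psi.
  have Bu : hdot u Psi = 0 by rewrite -uE; exact: BE.
  rewrite linearBl /= Bu subr0 hdotE ger0_norm ?exprn_ge0// expr2 ler_pM2r//.
  by move=> /(lt_le_trans Pu); rewrite ltxx.
have := state1 sw'; rewrite wE' Psi0 -[0](scale0r (0 : H)) linearZr_LR /= rmorph0 mul0r => /eqP.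
by rewrite eq_sym oner_eq0.
Qed.
End Equivalence.
Local Open Scope complex_scope.

Theorem theorem1p10 (R : realType) (n : nat) (hn : (2 <= n)%N)
    (A : cstarAlgType R) (s : 'I_n -> A) (hs : is_cuntz_algebra s) :
  [/\
   (* (i) *)
   forall (m a k l : nat) (z : 'rV[R[i]]_m),
     (1 <= a)%N -> m = (n.-1 * a + 1)%N ->
     (1 <= k)%N -> l = (m.-1 * k + 1)%N -> Wset z ->
     Wset (gp_vec k l z) /\
     forall w w' : A -> R[i],
       is_gp_state s z w -> is_gp_state s (gp_vec k l z) w' -> w = w',
   (* (ii) *)
   forall m l : nat,
     (exists2 a : nat, (1 <= a)%N & m = (n.-1 * a + 1)%N) ->
     (exists2 a : nat, (1 <= a)%N & l = (n.-1 * a + 1)%N) ->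
     (2 <= m)%N -> (m <= l)%N -> (m.-1 %| l.-1)%N ->
     gp_states s m `<=` gp_states s l,
   (* (iii) *)
   forall (m l p : nat) (z : 'rV[R[i]]_m) (y : 'rV[R[i]]_l)
       (w w' : A -> R[i]),
     (exists2 k : nat, (2 <= k)%N & m = (n.-1 * k + 1)%N) ->
     (exists2 k : nat, (2 <= k)%N & l = (n.-1 * k + 1)%N) ->
     p = (m.-1 * l.-1 + 1)%N -> Wset z -> Wset y ->
     is_gp_state s z w -> is_gp_state s y w' ->
     (state_equiv w w' <-> gp_vec l.-1 p z = gp_vec m.-1 p y)
   (* (iv) *)
 & forall (m k : nat) (y : 'rV[R[i]]_n),
     (2 <= k)%N -> m = (n.-1 * k + 1)%N -> unit_sphere y ->
     unit_sphere (gp_vec k m y) /\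
     forall (z : 'rV[R[i]]_m) (w w' : A -> R[i]),
       Wset z -> is_gp_state s z w -> is_cuntz_state s y w' ->
       (state_equiv w w' <-> `|centry y n| < 1 /\ z = gp_vec k m y)].
Proof.
case: n hn s hs => [//|q] /ltnSE q0 s [rel gen _] /=.
have Wgp m k l (z : 'rV[R[i]]_m) : (0 < m)%N -> (0 < k)%N ->
    l = (m.-1 * k + 1)%N -> Wset z -> Wset (gp_vec k l z).
  case: m z => [//|m] z _ k0 -> [hz z1]; split; first exact: unit_sphere_gp_vec.
  by rewrite gp_vec_last normrX expr_lt1.
split.
- move=> m a k l z a0 mE k0 lE Wz; have [hz _] := Wz.
  have Wh : Wset (gp_vec k l z) by apply: Wgp => //; rewrite mE addn1.
  split=> // w w' hw hw'.
  have lE' : l = (q * (a * k) + 1)%N by rewrite lE mE (addn1 (q * a)) mulnA.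
  apply: (gp_state_unique rel q0 gen lE' _ Wh _ hw'); first by rewrite muln_gt0 a0.
  exact: (gp_state_gp_vec rel q0 mE lE' a0 hz hw).
- move=> m l [a a0 mE] [b b0 lE] m2 ml /dvdnP[k kE] w [z Wz hw].
  have lE' : l = (m.-1 * k + 1)%N by rewrite mulnC -kE addn1 prednK//; lia.
  have k0 : (0 < k)%N by case: k kE {lE'} => [|//] e; move: m2 ml e; lia.
  exists (gp_vec k l z); first by apply: Wgp => //; lia.
  have [hz _] := Wz; apply: (gp_state_gp_vec rel q0 mE _ a0 hz hw).
  by rewrite lE' mE (addn1 (q * a)) mulnA.
- move=> m l p z y w w' [a a2 mE] [b b2 lE] pE Wz Wy hw hw'.
  have [hz _] := Wz; have [hy _] := Wy.
  (* Both states are rewritten with the common length [p], that is, with order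
     [a (l - 1) = b (m - 1)]. *)
  have pE1 : p = (q * (a * l.-1) + 1)%N by rewrite pE mE (addn1 (q * a)) mulnA.
  have pE2 : p = (q * (b * m.-1) + 1)%N by rewrite pE mulnC lE (addn1 (q * b)) mulnA.
  have a0 : (0 < a)%N by lia.
  have b0 : (0 < b)%N by lia.
  have l0 : (0 < l.-1)%N by rewrite lE addn1 muln_gt0 q0.
  have m0 : (0 < m.-1)%N by rewrite mE addn1 muln_gt0 q0.
  have gz : is_gp_state s (gp_vec l.-1 p z) w := gp_state_gp_vec rel q0 mE pE1 a0 hz hw.
  have gy : is_gp_state s (gp_vec m.-1 p y) w' := gp_state_gp_vec rel q0 lE pE2 b0 hy hw'.
  have Wgz : Wset (gp_vec l.-1 p z) by apply: Wgp => //; rewrite mE addn1.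
  have Wgy : Wset (gp_vec m.-1 p y) by apply: Wgp => //; rewrite ?pE 1?mulnC// lE addn1.
  have al0 : (0 < a * l.-1)%N by rewrite muln_gt0 a0.
  split=> [|e]; first exact: gp_state_equiv_eq pE1 al0 Wgz Wgy.1 gz gy.
  rewrite -e in gy; rewrite -(gp_state_unique rel q0 gen pE1 al0 Wgz gz gy).
  by case: hw => sw _ _; exact: state_equiv_refl sw.
move=> m k y k2 mE hy.
have hgy : unit_sphere (gp_vec k m y) by rewrite mE; exact: unit_sphere_gp_vec.
split=> // z w w' Wz hw [sw' wy].
have k0 : (0 < k)%N by lia.
(* A Cuntz state is a geometric progression state of order 1. *)
have gy : is_gp_state s y w'.
  rewrite /is_gp_state /= divnn q0; split=> //.
    move=> [|//] r _ /andP[r0 rq]; rewrite expr0 mul1r muln0 add0n.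
    have rq' : (r.-1 < q.+1)%N by lia.
    by rewrite -(prednK r0) /centry !(ent_ord _ (Ordinal rq')).
  by rewrite expr1 /centry !(ent_ord _ ord_max).
have ggy : is_gp_state s (gp_vec k m y) w'.
  have qE : q.+1 = (q * 1 + 1)%N by rewrite muln1 addn1.
  by apply: (gp_state_gp_vec rel q0 qE _ _ hy gy); rewrite ?mul1n.
have lastE : centry (gp_vec k m y) m = centry y q.+1 ^+ k by rewrite mE gp_vec_last.
split=> [e|[y1 zE]].
  have zE : z = gp_vec k m y by exact: gp_state_equiv_eq mE k0 Wz hgy hw ggy e.
  (* The last entry of [z] is now [y_n^k], so its modulus being below 1 forces [|y_n| < 1]. *)
  split=> //; have [_] := Wz; rewrite zE lastE normrX.
  by rewrite expr_lt1.
rewrite zE in hw Wz.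
rewrite -(gp_state_unique rel q0 gen mE k0 Wz hw ggy).
by case: hw => sw _ _; exact: state_equiv_refl sw.
Qed.
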